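(* Let $p$ be an odd prime, let $m \geq 0$ and $2m-1 \leq r \leq p-3$. Then $$\dfrac{V_{r+2+(m+1)(p-1)}}{D^{m+1}(V_{r+2})}\otimes V_{p-1}\simeq \mathrm{ind}_{T(\mathbb{F}_p)}^{G(\mathbb{F}_p)} \left( V_m\otimes \omega_2^{r+2-m} \right)$$ as representations of $G(\mathbb{F}_p)=\mathrm{GL}_2(\mathbb{F}_p)$ over $\mathbb{F}_{p^2}$, where on the right $V_m$ is restricted to $T(\mathbb{F}_p)$.
   Context: For $n\ge 0$, $V_n$ is the $n$-th symmetric power of the standard representation of $G(\mathbb{F}_p)$, identified with homogeneous polynomials $P(X,Y)$ of degree $n$ over $\mathbb{F}_p$, with action $\begin{pmatrix} a & b\\ c & d\end{pmatrix}\cdot P(X,Y)=P(aX+cY,bX+dY)$; scalars are extended to $\mathbb{F}_{p^2}$. $D=X^p\frac{\partial}{\partial X}+Y^p\frac{\partial}{\partial Y}$, a $G(\mathbb{F}_p)$-linear map $V_n\to V_{n+p-1}$, and $D^{m+1}$ is its $(m+1)$-fold composition. Fix $\alpha\in\mathbb{F}_{p^2}\setminus\mathbb{F}_p$ with $\alpha^2\in\mathbb{F}_p$. $T(\mathbb{F}_p)\subset G(\mathbb{F}_p)$ is the image of the embedding $i:\mathbb{F}_{p^2}^\times\hookrightarrow G(\mathbb{F}_p)$, $u+v\alpha\mapsto\begin{pmatrix} u & v\alpha^2\\ v & u\end{pmatrix}$, and $\omega_2:T(\mathbb{F}_p)\to\mathbb{F}_{p^2}^\times$ is the inverse of $i$.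 For a representation $\sigma$ of $T(\mathbb{F}_p)$ over $\mathbb{F}_{p^2}$, $\mathrm{ind}_{T(\mathbb{F}_p)}^{G(\mathbb{F}_p)}\sigma$ is the space of functions $f:G(\mathbb{F}_p)\to\sigma$ with $f(tg)=\sigma(t)f(g)$ for $t\in T(\mathbb{F}_p)$, with $G(\mathbb{F}_p)$ acting by right translation. *)

(* Defs.v *)
From HB Require Import structures.
From mathcomp Require Import all_boot all_order all_algebra all_fingroup all_field.
From mathcomp Require Import ring zify.
From mathcomp Require Import generic_quotient ring_quotient.
From mathcomp.multinomials Require Export mpoly.

Set Implicit Arguments.
Unset Strict Implicit.
Unset Printing Implicit Defensive.

Import GRing.Theory VectorInternalTheory.
Local Open Scope ring_scope.

(* Finite-dimensional representations (left actions) of a subgroup G of gT.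
   Only the values of the action on G are constrained. *)
Record rep (K : fieldType) (gT : finGroupType) (G : {group gT}) := Rep {
  rep_space :> vectType K;
  rep_act : gT -> 'End(rep_space);
  rep_act1 : rep_act 1%g = \1%VF;
  rep_actM : {in G &, forall g h,
    rep_act (g * h)%g = (rep_act g \o rep_act h)%VF} }.
Arguments rep_act {K gT G} r g.

Definition rep_iso (K : fieldType) (gT : finGroupType) (G : {group gT})
    (V W : rep K G) : Prop :=
  exists2 f : 'Hom(V, W), bijective f &
    {in G, forall g, forall v : V, f (rep_act V g v) = rep_act W g (f v)}.

Section Restriction.
Variables (K : fieldType) (gT : finGroupType) (G H : {group gT}).
Variables (sHG : H \subset G) (V : rep K G).

Lemma res_actM : {in H &, forall g h,
  rep_act V (g * h)%g = (rep_act V g \o rep_act V h)%VF}.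
Proof. by move=> g h Hg Hh; apply: rep_actM; apply: (subsetP sHG). Qed.

Definition res_rep : rep K H := Rep (rep_act1 V) res_actM.
End Restriction.

Section QuotientSpace.
Variables (K : fieldType) (V : vectType K) (U : {vspace V}).
Local Open Scope quotient_scope.

Definition vquot := Quotient.quot U.
HB.instance Definition _ := GRing.Zmodule.on vquot.

Definition vquot_pi (v : V) : vquot := \pi_(Quotient.quot U) v.

Lemma vquot_pi_surj (x : vquot) : exists v, vquot_pi v = x.
Proof. by exists (repr (x : (Quotient.quot U))); rewrite /vquot_pi reprK. Qed.

Lemma vquot_pi_eq v w : (vquot_pi v = vquot_pi w) <-> (v - w \in U).
Proof.
rewrite /vquot_pi (Quotient.idealrBE U v w); split; first by move=> ->.
by move/eqP.
Qed.

Lemma vquot_piD v w : vquot_pi (v + w) = vquot_pi v + vquot_pi w.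
Proof. by rewrite /vquot_pi [LHS]pi_addr. Qed.

Definition vquot_scale (a : K) (x : vquot) : vquot :=
  vquot_pi (a *: repr (x : (Quotient.quot U))).

Lemma vquot_scale_pi a v : vquot_scale a (vquot_pi v) = vquot_pi (a *: v).
Proof.
apply/vquot_pi_eq; rewrite -scalerBr rpredZ //.
by apply/vquot_pi_eq; rewrite /vquot_pi reprK.
Qed.

Fact vquot_scalerA a b x :
  vquot_scale a (vquot_scale b x) = vquot_scale (a * b) x.
Proof.
by have [v <-] := vquot_pi_surj x; rewrite !vquot_scale_pi scalerA.
Qed.
Fact vquot_scale1r : left_id 1 vquot_scale.
Proof.
by move=> x; have [v <-] := vquot_pi_surj x; rewrite vquot_scale_pi scale1r.
Qed.
Fact vquot_scalerDr : right_distributive vquot_scale +%R.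
Proof.
move=> a x y; have [v <-] := vquot_pi_surj x; have [w <-] := vquot_pi_surj y.
by rewrite -vquot_piD !vquot_scale_pi scalerDr vquot_piD.
Qed.
Fact vquot_scalerDl x : {morph vquot_scale^~ x : a b / a + b}.
Proof.
move=> a b; have [v <-] := vquot_pi_surj x.
by rewrite !vquot_scale_pi scalerDl vquot_piD.
Qed.

HB.instance Definition _ := GRing.Zmodule_isLmodule.Build K vquot
  vquot_scalerA vquot_scale1r vquot_scalerDr vquot_scalerDl.

Fact vquot_pi_is_linear : linear vquot_pi.
Proof. by move=> a v w; rewrite vquot_piD -vquot_scale_pi. Qed.
HB.instance Definition _ := GRing.isLinear.Build K V vquot _ vquot_pi
  vquot_pi_is_linear.

(* V / U is finite-dimensional, being isomorphic to a complement of U. *)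
Let C := (U^C)%VS.
Let pC := daddv_pi C U.

Fact vquot_vect_axiom : Vector.axiom (dim (subvs_of C)) vquot.
Proof.
have dCU : (C :&: U = 0)%VS by rewrite /C capvC capv_compl.
have dUC : (U :&: C = 0)%VS by rewrite /C capv_compl.
have pCD v : v - pC v \in U.
  rewrite -{1}(daddv_pi_add dCU (w := v)); last by rewrite addvC addv_complf memvf.
  by rewrite addrC addKr memv_pi.
have pCU u : u \in U -> pC u = 0.
  move=> Uu; have := daddv_pi_add dCU (w := u).
  rewrite addvC addv_complf memvf => /(_ isT).
  by rewrite (daddv_pi_id dUC Uu) => /(canRL (addrK _)); rewrite subrr.
pose f (x : vquot) := v2r (vsproj C (pC (repr (x : Quotient.quot U)))).
have fE v : f (vquot_pi v) = v2r (vsproj C (pC v)).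
  congr (v2r (vsproj C _)); apply/eqP; rewrite -subr_eq0 -linearB.
  by apply/eqP/pCU/vquot_pi_eq; rewrite /vquot_pi reprK.
exists f => [a x y|].
  have [v <-] := vquot_pi_surj x; have [w <-] := vquot_pi_surj y.
  by rewrite -[a *: _ + _]linearP !fE !linearP.
exists (fun r => vquot_pi (vsval (r2v r))) => [x|r].
  have [v <-] := vquot_pi_surj x; rewrite fE v2rK vsprojK ?memv_pi //.
  by apply/vquot_pi_eq; rewrite -opprB rpredN pCD.
by rewrite fE (daddv_pi_id dCU) ?subvsP // vsvalK r2vK.
Qed.
HB.instance Definition _ := Lmodule_hasFinDim.Build K vquot vquot_vect_axiom.
End QuotientSpace.

Section QuotientRep.
Variables (K : fieldType) (gT : finGroupType) (G : {group gT}).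
Variables (V : rep K G) (U : {vspace V}).

Definition subrep : Prop := {in G, forall g, (rep_act V g @: U <= U)%VS}.

Let piU : 'Hom(V, vquot U) := linfun (@vquot_pi K V U).

(* piU^-1 is a linear section of piU; for U stable under G the composite does
   not depend on it, see quot_actE. *)
Definition quot_act (g : gT) : 'End(vquot U) :=
  (piU \o rep_act V g \o piU^-1)%VF.

Fact piU_lfunVK x : piU ((piU^-1)%VF x) = x.
Proof.
apply: limg_lfunVK; have [v <-] := vquot_pi_surj x.
by apply/memv_imgP; exists v; rewrite ?memvf // lfunE.
Qed.

Hypothesis stU : subrep.

Lemma quot_actE g v : g \in G ->
  quot_act g (vquot_pi U v) = vquot_pi U (rep_act V g v).
Proof.
move=> Gg; rewrite !comp_lfunE lfunE /=; apply/vquot_pi_eq.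
rewrite -linearB; apply: (subvP (stU Gg)); apply: memv_img.
by apply/vquot_pi_eq; have := piU_lfunVK (vquot_pi U v); rewrite {1}lfunE.
Qed.

Fact quot_act1 : quot_act 1%g = \1%VF.
Proof.
apply/lfunP=> x; have [v <-] := vquot_pi_surj x.
by rewrite quot_actE // rep_act1 !id_lfunE.
Qed.

Fact quot_actM : {in G &, forall g h,
  quot_act (g * h)%g = (quot_act g \o quot_act h)%VF}.
Proof.
move=> g h Gg Gh; apply/lfunP=> x; have [v <-] := vquot_pi_surj x.
by rewrite comp_lfunE !quot_actE ?groupM // rep_actM // comp_lfunE.
Qed.

Definition quot_rep : rep K G := Rep quot_act1 quot_actM.
End QuotientRep.

(* For finite-dimensional V, the tensor product of V and W is modelled as
   Hom(V^*, W), the pure tensor of v and w being phi |-> phi(v) w; tensorP is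
   its universal property. *)
Section TensorSpace.
Variables (K : fieldType) (V W : vectType K).

Definition tensor := 'Hom('Hom(V, K^o), W).
HB.instance Definition _ := Vector.on tensor.

Definition tens_fun (v : V) (w : W) (phi : 'Hom(V, K^o)) : W :=
  (phi v : K) *: w.
Fact tens_fun_is_linear v w : linear (tens_fun v w).
Proof.
by move=> c phi psi; rewrite /tens_fun lfunE /= lfunE /= scalerDl scalerA.
Qed.
HB.instance Definition _ v w := GRing.isLinear.Build K 'Hom(V, K^o) W _
  (tens_fun v w) (tens_fun_is_linear v w).

Definition tens (v : V) (w : W) : tensor := linfun (tens_fun v w).

Lemma tensE v w phi : tens v w phi = (phi v : K) *: w.
Proof. by rewrite lfunE. Qed.

Lemma tens_linearl w : linear (tens^~ w).
Proof.
move=> c v v'; apply/lfunP=> phi; rewrite add_lfunE scale_lfunE !tensE linearP.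
by rewrite scalerDl scalerA.
Qed.

Lemma tens_linearr v : linear (tens v).
Proof.
move=> c w w'; apply/lfunP=> phi; rewrite add_lfunE scale_lfunE !tensE.
by rewrite scalerDr !scalerA mulrC.
Qed.

Lemma tensor_span (A : tensor) : A = \sum_(i < \dim {:V})
  tens (vbasis {:V})`_i (A (linfun (coord (vbasis {:V}) i : V -> K^o))).
Proof.
apply/lfunP=> phi; rewrite sum_lfunE; under eq_bigr do rewrite tensE.
transitivity (A (\sum_(i < \dim {:V}) (phi (vbasis {:V})`_i : K) *:
  linfun (coord (vbasis {:V}) i : V -> K^o))); last first.
  by rewrite linear_sum; apply: eq_bigr => i _; rewrite linearZ.
congr (A _); apply/lfunP=> v.
rewrite {1}(coord_vbasis (memvf v)) linear_sum sum_lfunE.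
by apply: eq_bigr => i _; rewrite linearZ lfunE /= lfunE /= [LHS]mulrC.
Qed.

Lemma tens_lfunP (X : vectType K) (f h : 'Hom(tensor, X)) :
  (forall v w, f (tens v w) = h (tens v w)) -> f = h.
Proof.
move=> fh; apply/lfunP=> A; rewrite (tensor_span A) !linear_sum.
by apply: eq_bigr => i _; apply: fh.
Qed.

Lemma tensorP (X : vectType K) (b : V -> W -> X) :
    (forall w, linear (b^~ w)) -> (forall v, linear (b v)) ->
  exists! h : 'Hom(tensor, X), forall v w, h (tens v w) = b v w.
Proof.
move=> bl br; pose e := vbasis {:V}.
pose h0 (A : tensor) : X :=
  \sum_(i < \dim {:V}) b e`_i (A (linfun (coord e i : V -> K^o))).
have h0lin : linear h0.
  move=> c A B; rewrite /h0 scaler_sumr -big_split; apply: eq_bigr => i _ /=.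
  by rewrite -br; congr b; rewrite lfunE /= lfunE.
pose h0L : {linear tensor -> X} :=
  HB.pack h0 (GRing.isLinear.Build K tensor X _ h0 h0lin).
exists (linfun h0L); split=> [v w|h' hh'].
  rewrite lfunE /= /h0 {2}(coord_vbasis (memvf v)) -/e.
  pose blL : {linear V -> X} :=
    HB.pack (b^~ w) (GRing.isLinear.Build K V X _ (b^~ w) (bl w)).
  rewrite -[RHS]/(blL _) linear_sum; apply: eq_bigr => i _.
  rewrite linearZ tensE lfunE /=.
  pose brL : {linear W -> X} :=
    HB.pack (b e`_i) (GRing.isLinear.Build K W X _ (b e`_i) (br e`_i)).
  by rewrite -[LHS]/(brL _) linearZ.
apply/lfunP=> A; rewrite lfunE /= [in RHS](tensor_span A) linear_sum.
by apply: eq_bigr => i _; apply/esym/hh'.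
Qed.
End TensorSpace.

Section TensorRep.
Variables (K : fieldType) (gT : finGroupType) (G : {group gT}).
Variables (V W : rep K G).

Definition precomp (g : gT) (phi : 'Hom(V, K^o)) : 'Hom(V, K^o) :=
  (phi \o rep_act V g)%VF.
Fact precomp_is_linear g : linear (precomp g).
Proof. by move=> c phi psi; rewrite /precomp comp_lfunDl -comp_lfunZl. Qed.
HB.instance Definition _ g := GRing.isLinear.Build K 'Hom(V, K^o) 'Hom(V, K^o) _
  (precomp g) (precomp_is_linear g).

Definition tens_act_fun (g : gT) (A : tensor V W) : tensor V W :=
  (rep_act W g \o A \o linfun (precomp g))%VF.
Fact tens_act_is_linear g : linear (tens_act_fun g).
Proof.
rewrite /tens_act_fun.
by move=> c A B; rewrite comp_lfunDr comp_lfunDl -comp_lfunZr -comp_lfunZl.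
Qed.
HB.instance Definition _ g := GRing.isLinear.Build K (tensor V W) (tensor V W) _
  (tens_act_fun g) (tens_act_is_linear g).

Definition tens_act (g : gT) : 'End(tensor V W) :=
  linfun (tens_act_fun g).

Lemma tens_actE g v w :
  tens_act g (tens v w) = tens (rep_act V g v) (rep_act W g w).
Proof.
rewrite lfunE /=; apply/lfunP=> phi.
by rewrite !comp_lfunE !tensE lfunE /= comp_lfunE linearZ.
Qed.

Fact tens_act1 : tens_act 1%g = \1%VF.
Proof.
by apply: tens_lfunP => v w; rewrite tens_actE !rep_act1 !id_lfunE.
Qed.

Fact tens_actM : {in G &, forall g h,
  tens_act (g * h)%g = (tens_act g \o tens_act h)%VF}.
Proof.
move=> g h Gg Gh; apply: tens_lfunP => v w.
by rewrite comp_lfunE !tens_actE !rep_actM // !comp_lfunE.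
Qed.

Definition tens_rep : rep K G := Rep tens_act1 tens_actM.
End TensorRep.

Section InducedRep.
Variables (K : fieldType) (gT : finGroupType) (H : {group gT}) (V : rep K H).

Definition ind_cond (t g : gT) (f : {ffun gT -> V}) : V :=
  f (t * g)%g - rep_act V t (f g).
Fact ind_cond_is_linear t g : linear (ind_cond t g).
Proof.
move=> c f f'; rewrite /ind_cond !ffunE linearP scalerBr opprD.
by rewrite addrACA.
Qed.
HB.instance Definition _ t g := GRing.isLinear.Build K {ffun gT -> V} V _
  (ind_cond t g)
  (ind_cond_is_linear t g).

Definition ind_space : {vspace {ffun gT -> V}} :=
  (\bigcap_(t in H) \bigcap_(g : gT)
     lker (linfun (ind_cond t g)))%VS.

Lemma ind_spaceP (f : {ffun gT -> V}) :
  reflect {in H, forall t, forall g, f (t * g)%g = rep_act V t (f g)}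
          (f \in ind_space).
Proof.
apply: (iffP idP) => [fI t Ht g | fI].
  move: fI; rewrite memvE => /subv_bigcapP/(_ t Ht)/subv_bigcapP/(_ g isT).
  by rewrite -memvE memv_ker lfunE /= subr_eq0 => /eqP.
rewrite memvE; apply/subv_bigcapP=> t Ht; apply/subv_bigcapP=> g _.
by rewrite -memvE memv_ker lfunE /= subr_eq0 fI.
Qed.

(* vsproj restricts to the identity on ind_space, which is stable under right
   translation, see ind_actE. *)
Definition rtrans (g : gT) (f : subvs_of ind_space) : subvs_of ind_space :=
  vsproj ind_space [ffun x => vsval f (x * g)%g].
Fact rtrans_is_linear g : linear (rtrans g).
Proof.
move=> c f f'; rewrite -linearP; congr vsproj.
by apply/ffunP=> x; rewrite !ffunE.
Qed.
HB.instance Definition _ g := GRing.isLinear.Build K (subvs_of ind_space)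
  (subvs_of ind_space) _
  (rtrans g) (rtrans_is_linear g).

Definition ind_act (g : gT) : 'End(subvs_of ind_space) :=
  linfun (rtrans g).

Lemma ind_actE g (f : subvs_of ind_space) x :
  vsval (ind_act g f) x = vsval f (x * g)%g.
Proof.
rewrite lfunE /= vsprojK ?ffunE //; apply/ind_spaceP=> t Ht y.
by rewrite !ffunE -mulgA; apply: (ind_spaceP _ (subvsP f)).
Qed.

Fact ind_act1 : ind_act 1%g = \1%VF.
Proof.
apply/lfunP=> f; apply/val_inj/ffunP=> x.
by rewrite [LHS]ind_actE mulg1 id_lfunE.
Qed.

Fact ind_actM : {in [set: gT] &, forall g h,
  ind_act (g * h)%g = (ind_act g \o ind_act h)%VF}.
Proof.
move=> g h _ _; apply/lfunP=> f; apply/val_inj/ffunP=> x.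
by rewrite [LHS]ind_actE comp_lfunE [RHS]ind_actE ind_actE mulgA.
Qed.

Definition ind_rep : rep K [set: gT] := Rep ind_act1 ind_actM.
End InducedRep.

Section CharacterRep.
Variables (K : fieldType) (gT : finGroupType) (G : {group gT}) (chi : gT -> K).
Hypotheses (chi1 : chi 1%g = 1)
  (chiM : {in G &, {morph chi : g h / (g * h)%g >-> g * h}}).

Fact char_act1 : chi 1%g *: \1%VF = \1%VF :> 'End(K^o).
Proof. by rewrite chi1 scale1r. Qed.
Fact char_actM : {in G &, forall g h, chi (g * h)%g *: \1%VF =
  (chi g *: \1 \o chi h *: \1)%VF :> 'End(K^o)}.
Proof.
by move=> g h Gg Gh; rewrite chiM // -comp_lfunZl -comp_lfunZr comp_lfun1l scalerA.
Qed.

Definition char_rep : rep K G := @Rep K gT G K^o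
  (fun g => chi g *: \1%VF) char_act1 char_actM.
End CharacterRep.

Section SymmetricPower.
Variables (p : nat) (K : fieldExtType 'F_p).
Local Notation GL2 := {'GL_2(p)}.
Implicit Types (g h : GL2) (P : {mpoly K[2]}).

Definition GL_entry g (i j : 'I_2) : 'F_p := (GLval g : 'M['F_p]_2) i j.

(* For g = (a b; c d), the pair (aX + cY, bX + dY), where 'X_0 and 'X_1 are
   the variables X and Y. *)
Definition GL_subst g : 2.-tuple {mpoly K[2]} :=
  [tuple (GL_entry g 0 0)%:A *: 'X_0 + (GL_entry g 1 0)%:A *: 'X_1;
         (GL_entry g 0 1)%:A *: 'X_0 + (GL_entry g 1 1)%:A *: 'X_1].

Lemma GL_substE g (j : 'I_2) :
  tnth (GL_subst g) j = \sum_(i < 2) (GL_entry g i j)%:A *: 'X_i.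
Proof.
rewrite big_ord_recl big_ord1 (_ : lift ord0 ord0 = 1); last exact/val_inj.
by rewrite (tnth_nth 0); case: j => [[|[|//]] lt_j] /=;
  congr ((GL_entry g _ _)%:A *: _ + (GL_entry g _ _)%:A *: _); apply: val_inj.
Qed.

Fact GL_subst_homog n g P : P \is n.-homog -> P \mPo GL_subst g \is n.-homog.
Proof.
move=> Pn; rewrite comp_mpolyEX big_seq; apply: rpred_sum => m mP.
apply: rpredZ; rewrite comp_mpolyX.
have <- : mdeg m = n by exact: dhomog_mf Pn _ mP.
rewrite mdegE.
elim/big_rec2: _ => [|i d Q _ Qd]; first exact: dhomog1.
apply: dhomogM Qd; rewrite -[X in X.-homog]mul1n; apply: dhomogMn.
rewrite GL_substE; apply: rpred_sum => k _; apply: rpredZ.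
by rewrite dhomogX; apply/eqP; exact: mdeg1.
Qed.

Definition sym_fun n g (P : dhomog 2 K n) : dhomog 2 K n :=
  DHomog (GL_subst_homog g (dhomog_is_dhomog P)).
Fact sym_fun_is_linear n g : linear (@sym_fun n g).
Proof. by move=> c P Q; apply/val_inj; rewrite /= linearP. Qed.
HB.instance Definition _ n g := GRing.isLinear.Build K (dhomog 2 K n)
  (dhomog 2 K n) _ (@sym_fun n g) (@sym_fun_is_linear n g).

Definition sym_act n g : 'End(dhomog 2 K n) := linfun (@sym_fun n g).

Fact sym_act1 n : sym_act n 1%g = \1%VF.
Proof.
apply/lfunP=> P; rewrite lfunE id_lfunE /=; apply/val_inj.
rewrite /= -[RHS]comp_mpoly_id; congr (_ \mPo _); apply: eq_from_tnth => j.
rewrite GL_substE tnth_mktuple (bigD1 j) //= big1 ?addr0 => [|i neq_ij].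
  by rewrite /GL_entry /= mxE eqxx scale1r scale1r.
by rewrite /GL_entry /= mxE (negPf neq_ij) scale0r scale0r.
Qed.

Fact GL_subst_comp g h P :
  P \mPo GL_subst (g * h)%g = (P \mPo GL_subst h) \mPo GL_subst g.
Proof.
have substX k f : 'X_k \mPo GL_subst f = tnth (GL_subst f) k.
  by rewrite comp_mpolyXU -tnth_nth.
rewrite [P \mPo GL_subst h]comp_mpolyEX linear_sum /= [LHS]comp_mpolyEX.
apply: eq_bigr => m _; rewrite comp_mpolyZ !comp_mpolyX rmorph_prod /=.
congr (_ *: _); apply: eq_bigr => j _; rewrite rmorphXn /=; congr (_ ^+ _).
rewrite !GL_substE linear_sum /=.
under [RHS]eq_bigr do rewrite comp_mpolyZ substX GL_substE scaler_sumr.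
rewrite exchange_big; apply: eq_bigr => i _ /=.
under eq_bigr do rewrite scalerA.
rewrite -scaler_suml /GL_entry /= mxE scaler_suml; congr (_ *: _).
by apply: eq_bigr => k _; rewrite mulr_algl scalerA mulrC.
Qed.

Fact sym_actM n : {in [set: GL2] &, forall g h,
  sym_act n (g * h)%g = (sym_act n g \o sym_act n h)%VF}.
Proof.
move=> g h _ _; apply/lfunP=> P; rewrite comp_lfunE !lfunE; apply/val_inj.
exact: GL_subst_comp.
Qed.

(* V_n with scalars extended to K. *)
Definition sym_rep n : rep K [set: GL2] := Rep (sym_act1 n) (@sym_actM n).

(* D = X^p d/dX + Y^p d/dY. *)
Definition theta P : {mpoly K[2]} := 'X_0 ^+ p * P^`M(0) + 'X_1 ^+ p * P^`M(1).

Fact theta_is_linear : linear theta.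
Proof.
move=> c P Q; rewrite /theta !linearP !mulrDr -!scalerAr scalerDr.
by rewrite addrACA.
Qed.
HB.instance Definition _ := GRing.isLinear.Build K {mpoly K[2]} {mpoly K[2]} _
  theta theta_is_linear.

Fact iter_theta_is_linear k : linear (iter k theta).
Proof. by elim: k => // k IHk c P Q; rewrite /= IHk linearP. Qed.

Fact thetaM P Q : theta (P * Q) = theta P * Q + P * theta Q.
Proof. by rewrite /theta !mderivM; ring. Qed.

Fact theta_X (i : 'I_2) : theta 'X_i = 'X_i ^+ p.
Proof.
have dX (j : 'I_2) : ('X_i : {mpoly K[2]})^`M(j) = (i == j)%:R.
  rewrite mderivX mnm1E; case: eqP => [->|_]; last by rewrite scale0r.
  by rewrite -{1}(add0m U_(j)%MM) addmK mpolyX0 scale1r.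
rewrite /theta !dX; case: i {dX} => [[|[|//]] i_lt] /=.
  by rewrite mulr1 mulr0 addr0; congr ('X_ _ ^+ _); apply: val_inj.
by rewrite mulr1 mulr0 add0r; congr ('X_ _ ^+ _); apply: val_inj.
Qed.

Fact theta1 : theta 1 = 0.
Proof.
have /eqP := thetaM 1 1; rewrite !mulr1 !mul1r -subr_eq0 opprD addNKr.
by rewrite oppr_eq0 => /eqP.
Qed.

Section PrimeLevel.
Hypothesis p_pr : prime p.

Fact theta_homog n P : P \is n.-homog -> theta P \is (n + p.-1).-homog.
Proof.
have p_gt0 := prime_gt0 p_pr.
move=> Pn; rewrite (mpolyE P) linear_sum big_seq /=; apply: rpred_sum => m mP.
have dm : mdeg m = n by exact: dhomog_mf Pn _ mP.
rewrite linearZ; apply: rpredZ.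
suff dX (i : 'I_2) : 'X_i ^+ p * ('X_[m] : {mpoly K[2]})^`M(i)
    \is (n + p.-1).-homog.
  by apply: rpredD; apply: dX.
rewrite mderivX -scalerAr; have [->|m_i] := eqVneq (m i) 0%N.
  by rewrite scale0r; apply: dhomog0.
have le_im : (U_(i) <= m)%MM by rewrite lep1mP.
have -> : (n + p.-1)%N = (p + mdeg (m - U_(i)))%N.
  have := mdegD (m - U_(i)) U_(i); rewrite submK // mdeg1 dm.
  by move: p_gt0; lia.
apply: rpredZ; apply: dhomogM; last by rewrite dhomogX; apply/eqP.
rewrite -[X in X.-homog]mul1n; apply: dhomogMn.
by rewrite dhomogX; apply/eqP; exact: mdeg1.
Qed.

Fact iter_theta_homog n k P :
  P \is n.-homog -> iter k theta P \is (n + k * p.-1).-homog.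
Proof.
move=> Pn; elim: k => [|k IHk]; first by rewrite addn0.
by rewrite iterS mulSn addnCA addnC; apply: theta_homog.
Qed.

Fact theta_subst g P : theta (P \mPo GL_subst g) = theta P \mPo GL_subst g.
Proof.
have pF : p \in [pchar 'F_p] by rewrite pchar_Fp.
have pK : p \in [pchar {mpoly K[2]}].
  apply/andP; split=> //; rewrite -mpolyC_nat -(rmorph_nat (in_alg K)).
  by rewrite (pcharf0 pF) rmorph0.
have frob (x : 'F_p) : x ^+ p = x by have := expf_card x; rewrite card_Fp.
have sumX (j : 'I_2) : 'X_j \mPo GL_subst g = tnth (GL_subst g) j.
  by rewrite comp_mpolyXU -tnth_nth.
have gX (j : 'I_2) : theta ('X_j \mPo GL_subst g) = theta 'X_j \mPo GL_subst g.
  rewrite theta_X rmorphXn /= sumX GL_substE linear_sum /=.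
  rewrite -(pFrobenius_autE pK) rmorph_sum /=; apply: eq_bigr => i _.
  rewrite linearZ /= theta_X pFrobenius_autE exprZn; congr (_ *: _).
  by rewrite -in_algE -rmorphXn /= frob.
have gM Q1 Q2 : theta (Q1 \mPo GL_subst g) = theta Q1 \mPo GL_subst g ->
    theta (Q2 \mPo GL_subst g) = theta Q2 \mPo GL_subst g ->
  theta ((Q1 * Q2) \mPo GL_subst g) = theta (Q1 * Q2) \mPo GL_subst g.
  by move=> g1 g2; rewrite rmorphM /= !thetaM rmorphD !rmorphM /= g1 g2.
have g1 : theta (1 \mPo GL_subst g) = theta 1 \mPo GL_subst g.
  by rewrite rmorph1 theta1 rmorph0.
rewrite (mpolyE P) (raddf_sum (comp_mpoly (GL_subst g))) !(raddf_sum theta).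
rewrite (raddf_sum (comp_mpoly (GL_subst g))) /=.
apply: eq_bigr => m _; rewrite comp_mpolyZ !linearZ /=.
congr (_ *: _); rewrite mpolyXE_id.
elim/big_ind: _ => // i _.
by elim: (m i) => [|k IHk]; rewrite ?expr0 // exprS; apply: gM.
Qed.

Definition Dpow_fun n k (P : dhomog 2 K n) : dhomog 2 K (n + k * p.-1) :=
  DHomog (iter_theta_homog k (dhomog_is_dhomog P)).
Fact Dpow_fun_is_linear n k : linear (@Dpow_fun n k).
Proof. by move=> c P Q; apply/val_inj; rewrite /= iter_theta_is_linear. Qed.
HB.instance Definition _ n k := GRing.isLinear.Build K (dhomog 2 K n)
  (dhomog 2 K (n + k * p.-1)) _ (@Dpow_fun n k) (@Dpow_fun_is_linear n k).

(* D^k : V_n -> V_(n + k(p-1)). *)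
Definition Dpow n k : 'Hom(sym_rep n, sym_rep (n + k * p.-1)) :=
  linfun (@Dpow_fun n k).

Lemma Dpow_equivariant n k g (P : sym_rep n) :
  Dpow n k (rep_act (sym_rep n) g P) =
  rep_act (sym_rep (n + k * p.-1)) g (Dpow n k P).
Proof.
rewrite /= !lfunE; apply/val_inj => /=; elim: k => // k IHk.
by rewrite !iterS IHk theta_subst.
Qed.

Lemma limg_Dpow_subrep n k :
  subrep (V := sym_rep (n + k * p.-1)) (limg (Dpow n k)).
Proof.
move=> g _; apply/subvP=> _ /memv_imgP[_ /memv_imgP[P _ ->] ->].
by rewrite -Dpow_equivariant memv_img ?memvf.
Qed.

Definition coker_Dpow n k : rep K [set: GL2] :=
  quot_rep (@limg_Dpow_subrep n k).
End PrimeLevel.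
End SymmetricPower.

Section Torus.
Variables (p : nat) (a : 'F_p).
Local Notation GL2 := {'GL_2(p)}.

Definition torus_mx (u v : 'F_p) : 'M['F_p]_2 :=
  \matrix_(i, j) (if i == j then u else if i == 0 then v * a else v).

(* The matrices (u va; v u) that are invertible: for a = alpha ^+ 2 with alpha
   not in 'F_p, these are the images of the nonzero u + v alpha, as shown by
   omega2_bij. *)
Definition torus_set : {set GL2} :=
  [set g : GL2 | [exists u, exists v, (GLval g : 'M['F_p]_2) == torus_mx u v]].

Lemma torusP (g : GL2) :
  reflect (exists u v, (GLval g : 'M['F_p]_2) = torus_mx u v) (g \in torus_set).
Proof.
rewrite inE; apply: (iffP existsP) => -[u].
  by case/existsP=> v /eqP guv; exists u, v.
by case=> v guv; exists u; apply/existsP; exists v; apply/eqP.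
Qed.

Fact torus_mx1 : torus_mx 1 0 = 1%:M.
Proof.
by apply/matrixP=> i j; rewrite !mxE mul0r; case: eqP => // _; case: ifP.
Qed.

Fact torus_mxM u v u' v' : torus_mx u v *m torus_mx u' v' =
  torus_mx (u * u' + v * v' * a) (u * v' + v * u').
Proof.
apply/matrixP=> i j; rewrite !mxE big_ord_recl big_ord1 !mxE.
by case: i j => [[|[|//]] i_lt] [[|[|//]] j_lt] /=; ring.
Qed.

Fact torus_group_set : group_set torus_set.
Proof.
apply/group_setP; split; first by apply/torusP; exists 1, 0; rewrite torus_mx1.
move=> g h /torusP[u [v guv]] /torusP[u' [v' huv]]; apply/torusP.
exists (u * u' + v * v' * a), (u * v' + v * u').
by rewrite -torus_mxM -guv -huv.
Qed.
Canonical torus : {group GL2} := Group torus_group_set.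

Variables (K : fieldExtType 'F_p) (alpha : K).

Definition omega2 (g : GL2) : K :=
  (GL_entry g 0 0)%:A + (GL_entry g 1 0)%:A * alpha.

Lemma omega2E (g : GL2) u v :
  (GLval g : 'M['F_p]_2) = torus_mx u v -> omega2 g = u%:A + v%:A * alpha.
Proof. by rewrite /omega2 /GL_entry => ->; rewrite !mxE. Qed.

Hypothesis alpha2 : alpha ^+ 2 = a%:A.

Fact omega2_1 : omega2 1%g = 1.
Proof. by rewrite (@omega2E _ 1 0) ?torus_mx1 // scale0r mul0r scale1r addr0. Qed.

Fact omega2M :
  {in torus &, {morph omega2 : g h / (g * h)%g >-> g * h}}.
Proof.
move=> g h /torusP[u [v guv]] /torusP[u' [v' huv]].
rewrite (omega2E guv) (omega2E huv).
rewrite (@omega2E _ (u * u' + v * v' * a) (u * v' + v * u')); last first.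
  by rewrite -torus_mxM -guv -huv.
have algM (c d : 'F_p) : (c * d)%:A = c%:A * d%:A :> K.
  exact: (rmorphM (in_alg K)).
rewrite !scalerDl !algM -alpha2.
by move: (u%:A : K) (v%:A : K) (u'%:A : K) (v'%:A : K) => U V U' V'; ring.
Qed.

Fact alg_alpha_inj u v u' v' : alpha \notin 1%VS ->
  u%:A + v%:A * alpha = u'%:A + v'%:A * alpha -> u = u' /\ v = v'.
Proof.
move=> alphaN /eqP; rewrite -subr_eq0 opprD addrACA -mulrBl -!scalerBl => /eqP.
have [/eqP|v_neq] := eqVneq (v - v') 0.
  rewrite subr_eq0 => /eqP-> /eqP; rewrite subrr scale0r mul0r addr0.
  by rewrite scaler_eq0 oner_eq0 orbF subr_eq0 => /eqP.
move/eqP; rewrite addr_eq0 mulr_algl => /eqP uv; case/negP: alphaN.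
have -> : alpha = (- (v - v')^-1 * (u - u'))%:A.
  by rewrite -scalerA uv scalerN scaleNr opprK scalerA mulVf // scale1r.
by rewrite rpredZ // rpred1.
Qed.

Lemma omega2_bij : \dim {:K} = 2 -> alpha \notin 1%VS -> forall x : K, x != 0 ->
  exists! g, g \in torus /\ omega2 g = x.
Proof.
move=> dimK alphaN x x_neq0.
have [u [v def_x]] : exists u v, x = u%:A + v%:A * alpha.
  have alpha0 : alpha != 0 by apply: contraNneq alphaN => ->; apply: rpred0.
  have dK : (1 + <[alpha]>)%VS = {:K}%VS.
    apply/eqP; rewrite eqEdim subvf dimK dimv_disjoint_sum.
      by rewrite dimv1 dim_vline alpha0.
    apply/eqP; rewrite -subv0; apply/subvP=> y /memv_capP[y1 /vlineP[c def_y]].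
    rewrite memv0 def_y scaler_eq0 (negPf alpha0) orbF.
    apply: contraNT alphaN => c_neq0.
    by rewrite -[alpha](scalerK c_neq0) -def_y rpredZ.
  have /memv_addP[y /vlineP[u ->] [z /vlineP[v ->] ->]] :
    x \in (1 + <[alpha]>)%VS by rewrite dK memvf.
  by exists u, v; rewrite mulr_algl.
have det_uv : \det (torus_mx u v) = u ^+ 2 - v ^+ 2 * a.
  rewrite (expand_det_row _ 0) big_ord_recl big_ord1 /cofactor !det_mx11 !mxE /=.
  by rewrite /= expr0 expr1; ring.
have unit_uv : (torus_mx u v : 'M['F_p]_(2.-1.+1)) \is a GRing.unit.
  rewrite -[_ \is a _]/(torus_mx u v \in unitmx) unitmxE unitfE det_uv.
  rewrite -(fmorph_eq0 (in_alg K)) rmorphB !expr2 !rmorphM /= -alpha2.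
  rewrite -!expr2 -exprMn subr_sqr -def_x mulf_neq0 //.
  apply: contraNneq x_neq0 => uv0.
  have [u0 /eqP] : u = 0 /\ - v = 0.
    by apply: alg_alpha_inj => //; rewrite !scale0r mul0r addr0 scaleNr mulNr.
  by rewrite oppr_eq0 def_x u0 => /eqP->; rewrite !scale0r mul0r addr0.
pose g : GL2 := FinRing.Unit unit_uv.
have guv : (GLval g : 'M['F_p]_2) = torus_mx u v by [].
exists g; split=> [|h [/torusP[u' [v' huv]] hx]].
  by split; [apply/torusP; exists u, v | rewrite (omega2E guv)].
have [|eq_u eq_v] := alg_alpha_inj (u := u) (v := v) (u' := u') (v' := v') alphaN.
  by rewrite -def_x -hx (omega2E huv).
by apply: val_inj; rewrite [LHS]guv [RHS]huv eq_u eq_v.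
Qed.

Fact omega2_exp1 (k : int) : omega2 1%g ^ k = 1.
Proof. by rewrite omega2_1 exp1rz. Qed.
Fact omega2_expM (k : int) : {in torus &,
  {morph (fun g => omega2 g ^ k) : g h / (g * h)%g >-> g * h}}.
Proof. by move=> g h Tg Th; rewrite /= omega2M // expfzMl. Qed.

Definition omega2_rep (k : int) : rep K torus :=
  char_rep (omega2_exp1 k) (@omega2_expM k).
End Torus.

(* Main.v *)
From HB Require Import structures.
Require Import Defs.
From mathcomp Require Import all_boot all_order all_algebra all_fingroup all_field.
From mathcomp Require Import pgroup ring zify.

Set Implicit Arguments.
Unset Strict Implicit.
Unset Printing Implicit Defensive.

Import GRing.Theory.
Local Open Scope ring_scope.

(** Let n = r + 2, N = n + (m+1)(p-1) and A = V_N / D^(m+1) V_n. Both sides have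
    dimension (m+1) p (p-1), so it is enough to find an injective equivariant
    map from A tensor V_(p-1) to the induced representation (tensor_ind_iso). By
    Frobenius reciprocity such a map is a map of representations of the torus T to
    V_m tensor omega^(n-m). Over K the target is the sum of the characters
    omega^(n+i(p-1)), 0 <= i <= m, so what is needed is one eigenfunctional B_i of T
    for each of these characters, such that no nonzero tensor is killed by all the
    translates of all the B_i.

    The cokernel A is filtered by the images of the powers of D. Let L be the
    Dickson invariant XY^p - X^pY, which D kills. In the affine chart X = 1, the
    operator D on forms of degree k is f |-> k f + tau f' with tau = Y^p - Y, and this
    makes the arithmetic of D and L transparent: when p does not divide k, every form
    of degree k + p - 1 is a multiple of L plus an element of D V_k (theta_decomp), and
    if D Q is a multiple of L then so is Q (theta_strict). The inequality 2m < n ensures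
    that this applies to all the degrees met and that D is injective there. So the layer
    of index m - i of the filtration is a copy of V_(n-2i+p-1) / D V_(n-2i), twisted by
    det^i, and T being of order prime to p, an eigenfunctional given on a layer extends
    to A and vanishes on the smaller steps of the filtration (level_functional). This
    reduces the construction of B_i to the case m = 0.

    In that case the functional is explicit (pairing). If v is a vector of K^2 whose line
    is fixed by T and w its conjugate, the coefficients of P(v + T w) are
    eigencoordinates of P; two combinations of them kill D V_n, and they are paired with
    the values of the second factor at v and at w.

    For injectivity, a nonzero stable subspace contains a nonzero vector fixed by the
    unipotent subgroup U (unipotent_fixed). As a representation of U, V_(p-1) is regular,
    generated by the form X^(p-1) - Y^(p-1), so a fixed vector is the sum of the
    translates by U of y tensor this form, for some y in A (fixed_spread). The value of
    the pairing at the translates of such a vector by the diagonal matrices (1, d) is a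
    sum over the F_p-translates of the point d alpha, which power sums over F_p reduce
    to a polynomial in z = -2 d alpha without constant term and of degree less than p. Its
    coefficients are those of y, in a basis of the bottom layer, times explicit nonzero
    constants (pairing_mono, base_coef_neq0). As z takes p - 1 nonzero values, y goes
    one step down the filtration each time, and it vanishes in the end. *)

(** * Evaluation of binary forms at points of a polynomial ring *)

Section Evaluation.
Variables (p : nat) (K : fieldExtType 'F_p).
Implicit Types (P Q : {mpoly K[2]}) (l : {poly K}).

Lemma mpoly2_ind (S : {mpoly K[2]} -> Prop) :
    (forall c, S c%:MP) -> S 'X_0 -> S 'X_1 ->
    (forall P Q, S P -> S Q -> S (P + Q)) ->
    (forall P Q, S P -> S Q -> S (P * Q)) ->
  forall P, S P.
Proof.
move=> SC S0 S1 SD SM P; rewrite (mpolyE P).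
elim/big_ind: _ => [|//|m _]; first by rewrite -mpolyC0.
rewrite -mul_mpolyC; apply: (SM) => //; rewrite mpolyXE_id.
elim/big_ind: _ => [||i _]; [by rewrite -mpolyC1 | exact: SM |].
elim: (m i) => [|k IHk]; first by rewrite expr0 -mpolyC1.
rewrite exprS; apply: SM => //; case: i {IHk} => [[|[|//]] lt_i].
  by rewrite (_ : Ordinal lt_i = 0) //; apply: val_inj.
by rewrite (_ : Ordinal lt_i = 1) //; apply: val_inj.
Qed.

(** Substituting one-variable polynomials for X and Y turns D, the torus
and the Borel subgroup into operations on {poly K}. Three substitutions are
used: the affine chart (1, T), the generic line through the torus-fixed points,
and the translates of that line. *)
Definition ev l0 l1 : {mpoly K[2]} -> {poly K} :=
  mmap polyC (fun i => if i == 0 then l0 else l1).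
HB.instance Definition _ l0 l1 := GRing.RMorphism.on (ev l0 l1).

Lemma evC l0 l1 c : ev l0 l1 c%:MP = c%:P. Proof. exact: mmapC. Qed.
Lemma evZ l0 l1 c P : ev l0 l1 (c *: P) = c *: ev l0 l1 P.
Proof. by rewrite /ev mmapZ mul_polyC. Qed.
HB.instance Definition _ l0 l1 := GRing.isScalable.Build K {mpoly K[2]} {poly K}
  _ (ev l0 l1) (evZ l0 l1).
Lemma ev0 l0 l1 : ev l0 l1 'X_0 = l0.
Proof. by rewrite /ev mmapX mmap1U. Qed.
Lemma ev1 l0 l1 : ev l0 l1 'X_1 = l1.
Proof. by rewrite /ev mmapX mmap1U. Qed.

Lemma ev_comp l0 l1 l2 P : ev (l0 \Po l2) (l1 \Po l2) P = ev l0 l1 P \Po l2.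
Proof.
elim/mpoly2_ind: P => [c|||P Q IP IQ|P Q IP IQ]; first by rewrite !evC comp_polyC.
- by rewrite !ev0.
- by rewrite !ev1.
- by rewrite !rmorphD /= IP IQ.
- by rewrite !rmorphM /= IP IQ.
Qed.

Lemma ev_subst (g : {'GL_2(p)}) l0 l1 P :
  ev l0 l1 (P \mPo GL_subst K g) =
  ev ((GL_entry g 0 0)%:A *: l0 + (GL_entry g 1 0)%:A *: l1)
     ((GL_entry g 0 1)%:A *: l0 + (GL_entry g 1 1)%:A *: l1) P.
Proof.
elim/mpoly2_ind: P => [c|||P Q IP IQ|P Q IP IQ].
- by rewrite comp_mpolyC !evC.
- by rewrite comp_mpolyXU ev0 /= rmorphD /= !linearZ /= ev0 ev1.
- by rewrite comp_mpolyXU ev1 /= rmorphD /= !linearZ /= ev0 ev1.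
- by rewrite !rmorphD /= IP IQ.
- by rewrite !rmorphM /= IP IQ.
Qed.

Lemma ev_homogE n l0 l1 P : P \is n.-homog ->
  ev l0 l1 P = \sum_(m <- msupp P) P@_m *: (l0 ^+ (n - m 1%R) * l1 ^+ m 1%R).
Proof.
move=> /dhomogP Pn; rewrite /ev /mmap big_seq [in RHS]big_seq; apply: eq_bigr => m mP.
rewrite mul_polyC /mmap1 big_ord_recl big_ord1 /=; congr (_ *: (_ ^+ _ * _ ^+ m _)).
  rewrite -(Pn _ mP) /= mdegE big_ord_recl big_ord1.
  by rewrite (_ : lift ord0 ord0 = 1) ?addnK //; apply: val_inj.
exact: val_inj.
Qed.

Lemma mdeg2 (m : 'X_{1..2}) : mdeg m = (m 0%R + m 1%R)%N.
Proof.
rewrite mdegE big_ord_recl big_ord1; congr (_ + m _)%N; exact: val_inj.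
Qed.

Lemma homog_le n P m : P \is n.-homog -> m \in msupp P -> (m 1%R <= n)%N.
Proof. by move=> /dhomogP Pn /Pn /= <-; rewrite mdeg2 leq_addl. Qed.

Lemma ev_scale n l0 l1 (w : {poly K}) P : P \is n.-homog ->
  ev (w * l0) (w * l1) P = w ^+ n * ev l0 l1 P.
Proof.
move=> Pn; rewrite !(ev_homogE _ _ Pn) big_seq [in RHS]big_seq mulr_sumr.
apply: eq_bigr => m mP; rewrite -scalerAr; congr (_ *: _).
by rewrite !exprMn mulrACA -exprD subnK // (homog_le Pn).
Qed.

Lemma ev_deriv l0 l1 P :
  (ev l0 l1 P)^`() = l0^`() * ev l0 l1 P^`M(0) + l1^`() * ev l0 l1 P^`M(1).
Proof.
have dX (i j : 'I_2) : ('X_i : {mpoly K[2]})^`M(j) = (i == j)%:R.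
  rewrite mderivX mnm1E; case: eqP => [->|_]; last by rewrite scale0r.
  by rewrite -{1}(add0m U_(j)%MM) addmK mpolyX0 scale1r.
elim/mpoly2_ind: P => [c|||P Q IP IQ|P Q IP IQ].
- by rewrite evC derivC !mderivC !rmorph0 !mulr0 addr0.
- by rewrite ev0 !dX rmorph1 rmorph0 mulr1 mulr0 addr0.
- by rewrite ev1 !dX rmorph1 rmorph0 mulr1 mulr0 add0r.
- by rewrite !(mderivD, rmorphD) /= derivD IP IQ; ring.
- by rewrite !mderivM !rmorphM /= derivM !rmorphD !rmorphM /= IP IQ; ring.
Qed.

Lemma ev_euler n l0 l1 P : P \is n.-homog ->
  l0 * ev l0 l1 P^`M(0) + l1 * ev l0 l1 P^`M(1) = n%:R * ev l0 l1 P.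
Proof.
move=> /dhomogP Pn.
have dE i : P^`M(i) = \sum_(m <- msupp P) P@_m *: ('X_[m])^`M(i).
  by rewrite {1}(mpolyE P) linear_sum; apply: eq_bigr => m _; rewrite linearZ.
rewrite !dE [in RHS](mpolyE P) !linear_sum /= !mulr_sumr -big_split /=.
rewrite [LHS]big_seq [RHS]big_seq; apply: eq_bigr => m mP; rewrite !evZ.
rewrite -!scalerAr -scalerDr; congr (_ *: _); rewrite !mderivX !evZ.
have dm : mdeg m = n by exact: Pn mP.
rewrite -dm mdeg2 natrD mulrDl -!scalerAr !scaler_nat !mulr_natl.
suff e i : (if i == 0 then l0 else l1) * ev l0 l1 'X_[m - U_(i)] *+ m i =
   ev l0 l1 'X_[m] *+ m i.
  by congr (_ + _); [apply: (e 0) | apply: (e 1)].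
have [->|mi] := eqVneq (m i) 0%N; first by rewrite !mulr0n.
have le_im : (U_(i) <= m)%MM by rewrite lep1mP.
rewrite -[X in _ = ev _ _ X *+ _](congr1 (fun m => mpolyX K m) (submK le_im)).
rewrite mpolyXD rmorphM /= [X in _ = X *+ _]mulrC.
by congr ((_ * _) *+ _); rewrite /ev mmapX mmap1U.
Qed.

(** D is the derivative along the Frobenius image of the point. When
that image is a combination of the velocity and the position of the curve
(l0, l1), the chain rule and the Euler identity express D in one variable. *)
Lemma ev_theta n l0 l1 A B P : P \is n.-homog ->
    l0 ^+ p = A * l0^`() + B * l0 -> l1 ^+ p = A * l1^`() + B * l1 ->
  ev l0 l1 (theta P) = A * (ev l0 l1 P)^`() + n%:R * B * ev l0 l1 P.
Proof.
move=> Pn e0 e1; rewrite -mulrA mulrCA -(ev_euler _ _ Pn) ev_deriv.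
by rewrite /theta rmorphD !rmorphM !rmorphXn /= ev0 ev1 e0 e1; ring.
Qed.

End Evaluation.

(** * Frobenius and dehomogenization *)

Section Dehomogenization.
Variables (p : nat) (K : fieldExtType 'F_p).
Hypothesis p_pr : prime p.
Implicit Types (P Q : {mpoly K[2]}) (f q h : {poly K}).

Let p_gt1 : (1 < p)%N := prime_gt1 p_pr.

Lemma pcharK : p \in [pchar K].
Proof.
apply/andP; split=> //; rewrite -(rmorph_nat (in_alg K)).
by rewrite pcharf0 ?rmorph0 // pchar_Fp.
Qed.

Lemma natK_eq0 k : (k%:R == 0 :> K) = (p %| k)%N.
Proof. by rewrite (dvdn_pcharf pcharK). Qed.

Lemma FpK_frob (x : 'F_p) : (x%:A : K) ^+ p = x%:A.
Proof.
by rewrite -in_algE -rmorphXn /=; have := expf_card x; rewrite card_Fp // => ->.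
Qed.

Lemma frobK_D (x y : K) : (x + y) ^+ p = x ^+ p + y ^+ p.
Proof. by rewrite -!(pFrobenius_autE pcharK) rmorphD. Qed.

Lemma frobX_D (f g : {poly K}) : (f + g) ^+ p = f ^+ p + g ^+ p.
Proof.
have pP : p \in [pchar {poly K}] by rewrite pchar_poly pcharK.
by rewrite -!(pFrobenius_autE pP) rmorphD.
Qed.

Local Notation eta := (ev 1 'X : {mpoly K[2]} -> {poly K}).

Lemma etaE n P : P \is n.-homog ->
  eta P = \sum_(m <- msupp P) P@_m *: 'X^(m 1%R).
Proof.
move=> Pn; rewrite (ev_homogE _ _ Pn); apply: eq_bigr => m _.
by rewrite expr1n mul1r.
Qed.

Lemma size_eta n P : P \is n.-homog -> (size (eta P) <= n.+1)%N.
Proof.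
move=> Pn; rewrite (etaE Pn) big_seq.
apply: (leq_trans (size_sum _ _ _)); apply/bigmax_leqP_seq => m mP _.
by rewrite (leq_trans (size_scale_leq _ _)) // size_polyXn ltnS (homog_le Pn).
Qed.

Lemma eta_inj n P : P \is n.-homog -> eta P = 0 -> P = 0.
Proof.
move=> Pn eP0; apply/mpolyP => m; rewrite mcoeff0.
have [mP|] := boolP (m \in msupp P); last exact: memN_msupp_eq0.
have /(congr1 (fun f : {poly K} => f`_(m 1%R))) := eP0.
rewrite (etaE Pn) coef_sum coef0 (bigD1_seq m) ?msupp_uniq //=.
rewrite coefZ coefXn eqxx mulr1 big1_seq ?addr0 // => m' /andP[mm' m'P].
rewrite coefZ coefXn; case: eqP => [e1|_]; last by rewrite mulr0.
case/negP: mm'; apply/eqP/mnmP => j.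
have [/dhomogP dP] := Pn; have := dP _ mP; rewrite -(dP _ m'P) /= !mdeg2 e1.
move/addIn => e0; case: j => [[|[|//]] lt_j].
  by rewrite (_ : Ordinal lt_j = 0) //; apply: val_inj.
by rewrite (_ : Ordinal lt_j = 1) //; apply: val_inj.
Qed.

Lemma eta_inj2 n P Q : P \is n.-homog -> Q \is n.-homog ->
  eta P = eta Q -> P = Q.
Proof.
move=> Pn Qn ePQ; apply/eqP; rewrite -subr_eq0; apply/eqP.
by apply: (@eta_inj n); rewrite ?rpredB // rmorphB /= ePQ subrr.
Qed.

Lemma dhomogXX a b : ('X_0 ^+ a * 'X_1 ^+ b : {mpoly K[2]}) \is (a + b).-homog.
Proof.
have dX (i : 'I_2) c : ('X_i ^+ c : {mpoly K[2]}) \is c.-homog.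
  rewrite -[X in X.-homog]mul1n; apply: dhomogMn.
  by rewrite dhomogX; apply/eqP; exact: mdeg1.
exact: dhomogM.
Qed.

Lemma eta_surj n f : (size f <= n.+1)%N -> exists2 P, P \is n.-homog & eta P = f.
Proof.
move=> le_fn; exists (\sum_(i < n.+1) f`_i *: ('X_0 ^+ (n - i) * 'X_1 ^+ i)).
  apply: rpred_sum => i _; apply: rpredZ.
  by have := dhomogXX (n - i) i; rewrite subnK // leq_ord.
rewrite rmorph_sum /=; under eq_bigr do
  rewrite evZ rmorphM !rmorphXn /= ev0 ev1 expr1n mul1r.
rewrite -poly_def; apply/polyP => i; rewrite coef_poly; case: ltnP => // lt_ni.
by rewrite nth_default // (leq_trans le_fn).
Qed.

(** The image of the Dickson invariant in the affine chart; its
derivative is -1, which is what makes D tractable there. *)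
Definition tau : {poly K} := 'X^p - 'X.

Lemma size_tau : size tau = p.+1.
Proof.
by rewrite /tau size_polyDl size_polyXn // size_polyN size_polyX ltnS.
Qed.

Lemma tau_neq0 : tau != 0.
Proof. by rewrite -size_poly_eq0 size_tau. Qed.

Lemma deriv_tau : tau^`() = -1.
Proof.
rewrite /tau derivB derivXn derivX -mulr_natr -polyC_natr.
by rewrite (pcharf0 pcharK) mulr0 sub0r.
Qed.

Lemma eta_theta n P : P \is n.-homog ->
  eta (theta P) = n%:R * eta P + tau * (eta P)^`().
Proof.
move=> Pn; rewrite (ev_theta (A := tau) (B := 1) Pn); first by rewrite mulr1 addrC.
  by rewrite expr1n derivC mulr0 add0r mul1r.
by rewrite derivX !mulr1 mul1r subrK.
Qed.

(** In degree k, the chart turns D into q |-> k q + tau q'. Modulo tau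
this is multiplication by the unit k, so every f is D q up to a multiple of tau.
The bounds say that the multiple also vanishes at infinity, so that it comes from
a form divisible by the Dickson invariant. *)
Lemma theta_div k f : (p <= k)%N -> k%:R != 0 :> K -> (size f <= k + p)%N ->
  exists q h, [/\ (size q <= k.+1)%N, (size h <= k.-1)%N &
    f = tau * h + (k%:R * q + tau * q^`())].
Proof.
move=> le_pk k0 sf; set c := f`_(k + p).-1.
(* the top coefficient is the value at infinity: clear it before dividing by tau *)
pose q1 := (c / k%:R) *: 'X^k.
have sq1 : (size q1 <= k.+1)%N by rewrite (leq_trans (size_scale_leq _ _)) ?size_polyXn.
pose f1 := f - (k%:R * q1 + tau * q1^`()).
have k_gt0 : (0 < k)%N by lia.
have eq1 : k%:R * q1 + tau * q1^`() = c *: 'X^((k + p).-1).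
  have Xk : 'X^k = 'X * 'X^(k.-1) :> {poly K} by rewrite -exprS prednK.
  have Xkp : 'X^((k + p).-1) = 'X^p * 'X^(k.-1) :> {poly K}.
    by rewrite -exprD; congr ('X^_); lia.
  have ec : c%:P = (c / k%:R)%:P * k%:R :> {poly K}.
    by rewrite -polyC_natr -polyCM divfK.
  rewrite /q1 derivZ derivXn -!mul_polyC ec Xkp Xk -mulr_natl /tau.
  by ring.
have sf1 : (size f1 <= (k + p).-1)%N.
  rewrite /f1 eq1; apply/leq_sizeP => j le_j; rewrite coefB coefZ coefXn.
  case: eqP => [->|/eqP nj]; first by rewrite mulr1 subrr.
  by rewrite mulr0 subr0 nth_default // (leq_trans sf) //; lia.
pose r := f1 %% tau; pose g := f1 %/ tau.
have sr : (size r <= p)%N.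
  by rewrite -ltnS -size_tau /r ltn_modp tau_neq0.
have sg : (size g <= k.-1)%N.
  by rewrite /g size_divp ?tau_neq0 // size_tau /= leq_subLR (leq_trans sf1) //; lia.
exists (q1 + k%:R^-1 *: r), (g - k%:R^-1 *: r^`()); split.
- rewrite (leq_trans (size_polyD _ _)) // geq_max sq1.
  by rewrite (leq_trans (size_scale_leq _ _)) // (leq_trans sr) //; lia.
- rewrite (leq_trans (size_polyD _ _)) // geq_max sg size_polyN.
  rewrite (leq_trans (size_scale_leq _ _)) //.
  have [->|r0] := eqVneq r 0; first by rewrite derivC size_poly0.
  by rewrite -ltnS (leq_trans (lt_size_deriv r0)) // (leq_trans sr) //; lia.
have ef : f = f1 + (k%:R * q1 + tau * q1^`()) by rewrite /f1 subrK.
have er : r = k%:R * (k%:R^-1 *: r).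
  by rewrite -polyC_natr mul_polyC scalerA mulfV // scale1r.
rewrite ef {1}(divp_eq f1 tau) -/r -/g derivD (derivZ k%:R^-1 r) [X in _ * _ + X + _]er.
by ring.
Qed.

(** The same remark: if tau divides k q + tau q' then it divides q.
Since tau' = -1, the quotient satisfies the equation of degree k - 1, which in
characteristic p is that of the forms of degree k - (p + 1). *)
Lemma theta_dvd k q h : (0 < k)%N -> k%:R != 0 :> K -> (size q <= k.+1)%N ->
    (size h <= k.-1)%N -> k%:R * q + tau * q^`() = tau * h ->
  exists q1, [/\ q = tau * q1, (size q1 <= k - p)%N &
    h = k.-1%:R * q1 + tau * q1^`()].
Proof.
move=> k_gt0 k0 sq sh e.
have kP (f : {poly K}) : k%:R * f = k%:R *: f by rewrite -polyC_natr mul_polyC.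
have /dvdpP[q1 eq1] : tau %| q.
  rewrite -(dvdpZr _ _ k0) -kP.
  rewrite (canRL (addrK _) e) -mulrBr; exact: dvdp_mulIl.
have {}eq1 : q = tau * q1 by rewrite mulrC.
exists q1; split=> //.
  (* the coefficient of degree k + p - 1 of the equation: q vanishes at infinity too *)
  have qk0 : q`_k = 0.
    have /(congr1 (fun f : {poly K} => f`_(k + p).-1)) := e.
    rewrite [RHS]nth_default; last first.
      by rewrite (leq_trans (size_polyMleq _ _)) // size_tau; lia.
    rewrite coefD kP coefZ nth_default; last by rewrite (leq_trans sq) //; lia.
    rewrite mulr0 add0r /tau mulrBl coefB coefXnM coefXM.
    rewrite (_ : ((k + p).-1 - p = k.-1)%N); last by lia.
    have -> : ((k + p).-1 < p)%N = false by lia.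
    have -> : ((k + p).-1 == 0%N) = false by lia.
    rewrite [q^`()`_(_.-2)]nth_default; last first.
      rewrite (leq_trans (size_poly _ _)) // -subn1 leq_subLR (leq_trans sq) //.
      by lia.
    rewrite coef_deriv prednK //.
    by rewrite subr0 -mulr_natr => /eqP; rewrite mulf_eq0 (negPf k0) orbF => /eqP.
  have sqk : (size q <= k)%N.
    apply/leq_sizeP => j; rewrite leq_eqVlt => /predU1P[<- //|lt_kj].
    by rewrite nth_default // (leq_trans sq).
  have [->|q10] := eqVneq q1 0; first by rewrite size_poly0.
  move: sqk; rewrite eq1 size_mul ?tau_neq0 // size_tau addSn /= => sqk.
  by rewrite leq_subRL // (leq_trans _ sqk) // leq_addr.
apply: (mulfI tau_neq0); rewrite -e eq1 derivM deriv_tau.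
have -> : k%:R = k.-1%:R + 1 :> {poly K} by rewrite natr1 prednK.
by ring.
Qed.

End Dehomogenization.

(** * The Dickson invariant and the operator D *)

Section Dickson.
Variables (p : nat) (K : fieldExtType 'F_p).
Hypothesis p_pr : prime p.
Implicit Types (P Q : {mpoly K[2]}).

Let p_gt1 : (1 < p)%N := prime_gt1 p_pr.
Local Notation eta := (ev 1 'X : {mpoly K[2]} -> {poly K}).
Local Notation tau := (tau K).
Local Notation theta := (@theta p K).

(** The product of the linear forms over F_p, up to sign: GL_2(F_p) acts
on it by the determinant and D kills it. *)
Definition dickson : {mpoly K[2]} := 'X_0 * 'X_1 ^+ p - 'X_0 ^+ p * 'X_1.
Local Notation L := dickson.

Lemma dickson_homog i : L ^+ i \is (i * p.+1).-homog.
Proof.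
rewrite mulnC; apply: dhomogMn; apply: rpredB.
  by have := dhomogXX K 1 p; rewrite expr1 add1n.
by have := dhomogXX K p 1; rewrite expr1 addn1.
Qed.

Lemma eta_dickson : eta L = tau.
Proof. by rewrite rmorphB !rmorphM !rmorphXn /= ev0 ev1 expr1n !mul1r. Qed.

Lemma thetaXn P k : theta (P ^+ k) = P ^+ k.-1 * theta P *+ k.
Proof.
elim: k => [|k IHk]; first by rewrite expr0 theta1 mulr0n.
rewrite exprS thetaM IHk; case: k {IHk} => [|k] /=.
  by rewrite !mulr0n mulr0 addr0 mulrC.
by rewrite mulrnAr mulrA -exprS [theta P * _]mulrC -mulrS.
Qed.

Lemma theta_dickson i P : theta (L ^+ i * P) = L ^+ i * theta P.
Proof.
suff D0 : theta L = 0 by rewrite thetaM thetaXn D0 mulr0 mul0rn mul0r add0r.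
have pchp : p%:R = 0 :> {mpoly K[2]}.
  by rewrite -mpolyC_nat (pcharf0 (pcharK K p_pr)) mpolyC0.
have Xp0 (i' : 'I_2) : theta ('X_i' ^+ p) = 0.
  by rewrite thetaXn -mulr_natl pchp mul0r.
by rewrite /L linearB /= !thetaM !Xp0 !theta_X !mulr0 mul0r addr0 add0r subrr.
Qed.

Lemma dickson_subst (g : {'GL_2(p)}) :
  L \mPo GL_subst K g =
  (GL_entry g 0 0 * GL_entry g 1 1 - GL_entry g 0 1 * GL_entry g 1 0)%:A *: L.
Proof.
have frob (x : 'F_p) : x ^+ p = x by have := expf_card x; rewrite card_Fp.
apply: (@eta_inj2 _ _ p.+1).
- by apply: GL_subst_homog; have := dickson_homog 1; rewrite expr1 mul1n.
- by apply: rpredZ; have := dickson_homog 1; rewrite expr1 mul1n.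
rewrite ev_subst linearZ /= eta_dickson.
rewrite rmorphB !rmorphM !rmorphXn /= ev0 ev1 !(frobX_D p_pr) !exprZn !frob !expr1n.
move: (GL_entry g 0 0) (GL_entry g 0 1) (GL_entry g 1 0) (GL_entry g 1 1) => a b c d.
have -> : (a * d - b * c)%:A = a%:A * d%:A - b%:A * c%:A :> K.
  by rewrite -!in_algE rmorphB !rmorphM.
move: (a%:A) (b%:A) (c%:A) (d%:A) => {}a {}b {}c {}d.
rewrite /tau -!mul_polyC polyCB !polyCM.
by ring.
Qed.

Section Level.
Variables (i n : nat).
Hypotheses (n_gt0 : (0 < n)%N) (lt_nip : (n + i < p)%N).

Let natk j : (j <= i)%N -> (n + j * p.+1)%:R != 0 :> K.
Proof.
move=> le_ji; rewrite natK_eq0 // mulnS addnA dvdn_addl ?dvdn_mull //.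
by rewrite gtnNdvd //; lia.
Qed.

(** Repeated division by the Dickson invariant. The degrees met,
n + j(p+1) with j <= i, are prime to p because 0 < n + j < p. *)
Lemma theta_decomp P : P \is (n + i * p.+1 + p.-1).-homog ->
  exists P' Q, [/\ P' \is (n + p.-1).-homog, Q \is (n + i * p.+1).-homog &
    P = L ^+ i * P' + theta Q].
Proof.
suff H j : (j <= i)%N -> forall P, P \is (n + j * p.+1 + p.-1).-homog ->
  exists P' Q, [/\ P' \is (n + p.-1).-homog, Q \is (n + j * p.+1).-homog &
    P = L ^+ j * P' + theta Q] by apply: H.
elim: j => [_ {}P|j IHj lt_ji {}P] Ph.
  exists P, 0; split; [by rewrite addn0 in Ph | exact: rpred0 |].
  by rewrite expr0 mul1r raddf0 addr0.
set k := (n + j.+1 * p.+1)%N in Ph *.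
have k0 : k%:R != 0 :> K by apply: natk.
have le_pk : (p <= k)%N by rewrite /k mulSn; lia.
have [|q [h [sq sh e]]] := @theta_div p K p_pr k (eta P) le_pk k0.
  by rewrite (leq_trans (size_eta Ph)) // addnC; lia.
have [Q Qh eQ] := eta_surj sq.
have [|H Hh eH] := @eta_surj _ K (n + j * p.+1 + p.-1) h.
  by rewrite (leq_trans sh) // /k mulSn; lia.
have [|P' [Q' [P'h Q'h eP']]] := IHj _ H Hh; first exact: ltnW.
exists P', (Q + L * Q'); split=> //.
  rewrite rpredD //; have := dhomogM (dickson_homog 1) Q'h.
  by rewrite expr1 mul1n addnCA /k mulSn.
have LH : P = L * H + theta Q.
  apply: (@eta_inj2 _ _ (k + p.-1)) => //.
    apply: rpredD; last exact: theta_homog.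
    have := dhomogM (dickson_homog 1) Hh.
    by rewrite expr1 mul1n /k mulSn !addnA [(p.+1 + n)%N]addnC.
  by rewrite rmorphD rmorphM /= eta_dickson (eta_theta Qh) eQ eH.
rewrite LH eP' raddfD /=; have := theta_dickson 1 Q'; rewrite expr1 => ->.
by rewrite exprS; ring.
Qed.

(** With the previous lemma, multiplication by the i-th power of the
Dickson invariant identifies the cokernel of D on V_n with the one on
V_(n+i(p+1)). *)
Lemma theta_strict P Q : P \is (n + p.-1).-homog ->
    Q \is (n + i * p.+1).-homog -> L ^+ i * P = theta Q ->
  exists2 Q', Q' \is n.-homog & P = theta Q' /\ Q = L ^+ i * Q'.
Proof.
move=> Ph; suff H j : (j <= i)%N -> forall Q, Q \is (n + j * p.+1).-homog ->
  L ^+ j * P = theta Q ->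
  exists2 Q', Q' \is n.-homog & P = theta Q' /\ Q = L ^+ j * Q' by apply: H.
elim: j => [_ {}Q|j IHj lt_ji {}Q] Qh.
  rewrite expr0 mul1r => e; exists Q; first by rewrite addn0 in Qh.
  by rewrite mul1r.
set k := (n + j.+1 * p.+1)%N in Qh *; move=> e.
have k0 : k%:R != 0 :> K by apply: natk.
have LPh : L ^+ j * P \is (n + j * p.+1 + p.-1).-homog.
  by rewrite addnAC addnC; apply: dhomogM => //; apply: dickson_homog.
have [|||||q1 [eq1 sq1 eh]] := @theta_dvd p K p_pr k (eta Q) (eta (L ^+ j * P)).
- by rewrite /k; lia.
- exact: k0.
- exact: size_eta.
- by rewrite (leq_trans (size_eta LPh)) // /k mulSn; lia.
- by rewrite -(eta_theta Qh) -e exprS -mulrA rmorphM /= eta_dickson.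
have [|Q1 Q1h eQ1] := @eta_surj _ K (n + j * p.+1) q1.
  by rewrite (leq_trans sq1) // /k mulSn; lia.
have QE : Q = L * Q1.
  apply: (eta_inj2 Qh).
    by have := dhomogM (dickson_homog 1) Q1h; rewrite expr1 mul1n addnCA /k mulSn.
  by rewrite rmorphM /= eta_dickson eQ1.
have [||Q' Q'h [eP eQ']] := IHj _ Q1 Q1h; first exact: ltnW.
  apply: (mulfI (_ : L != 0)).
    apply/eqP => /(congr1 eta) /eqP; rewrite eta_dickson rmorph0.
    by rewrite (negPf (tau_neq0 K p_pr)).
  by rewrite mulrA -exprS e QE; have := theta_dickson 1 Q1; rewrite expr1.
by exists Q' => //; split=> //; rewrite QE eQ' exprS mulrA.
Qed.

Lemma theta_inj Q : Q \is (n + i * p.+1).-homog -> theta Q = 0 -> Q = 0.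
Proof.
move=> Qh e; have [||Q' Q'h [e' ->]] := @theta_strict 0 Q _ Qh.
- exact: rpred0.
- by rewrite mulr0.
suff -> : Q' = 0 by rewrite mulr0.
apply: (eta_inj Q'h); apply/eqP; rewrite -size_poly_eq0; apply/eqP.
have n0 : n%:R != 0 :> K by have := natk (leq0n i); rewrite addn0.
have [|||q1 [-> sq1 _]] := @theta_dvd p K p_pr n (eta Q') 0 n_gt0 n0.
- exact: size_eta.
- by rewrite size_poly0.
- by rewrite -(eta_theta Q'h) -e' rmorph0 mulr0.
have: (size q1 <= 0)%N by rewrite (leq_trans sq1) //; lia.
by rewrite leqn0 size_poly_eq0 => /eqP->; rewrite mulr0 size_poly0.
Qed.
End Level.

Lemma iter_theta_subst (g : {'GL_2(p)}) e P :
  iter e theta P \mPo GL_subst K g = iter e theta (P \mPo GL_subst K g).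
Proof. by elim: e => // e IHe; rewrite !iterS -theta_subst // IHe. Qed.

Lemma iter_thetaZ e c P : iter e theta (c *: P) = c *: iter e theta P.
Proof. by elim: e => // e IHe; rewrite !iterS IHe linearZ. Qed.

Lemma iterD_theta e P Q :
  iter e theta (P + Q) = iter e theta P + iter e theta Q.
Proof. by elim: e => // e IHe; rewrite !iterS IHe raddfD. Qed.

(** The degree n + s(p-1) equals (n-2s) + s(p+1), and n - 2s > 0 as long
as s <= m: this is where the inequality 2m < n is needed. *)
Lemma iter_theta_inj n m s e P : (2 * m < n)%N -> (n < p)%N ->
    (s + e <= m.+1)%N -> P \is (n + s * p.-1).-homog ->
  iter e theta P = 0 -> P = 0.
Proof.
move=> le_mn lt_np; elim: e => // e IHe le_se Ph; rewrite iterS => e0.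
apply: IHe => //; first by lia.
have := iter_theta_homog p_pr e Ph.
have -> : (n + s * p.-1 + e * p.-1 = (n - 2 * (s + e)) + (s + e) * p.+1)%N by nia.
by move=> eh; apply: (theta_inj _ _ eh e0); lia.
Qed.

End Dickson.

(** * Evaluation at the fixed point of the torus *)

Section TorusPoint.
Variables (p : nat) (K : fieldExtType 'F_p).
Hypotheses (p_pr : prime p) (p_odd : odd p).
Variables (alpha : K) (a : 'F_p).
Hypotheses (alphaN : alpha \notin 1%VS) (alpha2 : alpha ^+ 2 = a%:A).
Implicit Types (P Q : {mpoly K[2]}).

Let p_gt1 : (1 < p)%N := prime_gt1 p_pr.

(** The p-th power of alpha is a square root of its square, and it is not
alpha since the fixed points of Frobenius lie in the prime field. *)
Lemma alpha_frob : alpha ^+ p = - alpha.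
Proof.
have: (alpha ^+ p) ^+ 2 == alpha ^+ 2.
  by rewrite -exprM mulnC exprM alpha2 FpK_frob.
rewrite eqf_sqr => /orP[|/eqP//] /eqP frob_a; case/negP: alphaN.
have := finField_genPoly 'F_p => /(congr1 (fun f => (map_poly (in_alg K) f).[alpha])).
rewrite rmorphB rmorph_prod /= map_polyXn map_polyX hornerD hornerN hornerXn.
rewrite hornerX card_Fp // frob_a subrr horner_prod => /esym/eqP.
rewrite prodf_seq_eq0 => /hasP[x _]; rewrite rmorphB /= map_polyX map_polyC.
by rewrite hornerXsubC subr_eq0 => /eqP->; rewrite rpredZ // rpred1.
Qed.

Lemma alpha_neq0 : alpha != 0.
Proof. by apply: contraNneq alphaN => ->; apply: rpred0. Qed.

(** The torus fixes the lines spanned by v = (1, alpha) and its conjugate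
w = (1, -alpha); psi P is P(v + T w). Its coefficients are the coordinates of P in
the basis of torus eigenvectors, and for j < p the coefficient of degree j is, up to
j!, the value of D^j P at v. *)
Definition psi : {mpoly K[2]} -> {poly K} := ev (1 + 'X) (alpha *: (1 - 'X)).
HB.instance Definition _ := GRing.RMorphism.on psi.
HB.instance Definition _ := GRing.Linear.on psi.

Lemma psi_theta n P : P \is n.-homog ->
  psi (theta P) = (1 - 'X^(p.+1)) * (psi P)^`() + n%:R * 'X^p * psi P.
Proof.
move=> Pn; have N1p : (-1 : {poly K}) ^+ p = -1.
  by rewrite -signr_odd p_odd expr1.
apply: (ev_theta Pn).
  by rewrite frobX_D // derivD derivC derivX expr1n exprSr; ring.
rewrite exprZn alpha_frob frobX_D // exprNn N1p expr1n derivZ derivB derivC derivX.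
by rewrite exprSr -!mul_polyC polyCN; ring.
Qed.

Lemma size_psi n P : P \is n.-homog -> (size (psi P) <= n.+1)%N.
Proof.
move=> Pn; rewrite /psi (ev_homogE _ _ Pn) big_seq.
apply: (leq_trans (size_sum _ _ _)); apply/bigmax_leqP_seq => m mP _.
rewrite (leq_trans (size_scale_leq _ _)) // (leq_trans (size_polyMleq _ _)) //.
have sl (l : {poly K}) k : (size l <= 2)%N -> (size (l ^+ k) <= k.+1)%N.
  move=> sl; rewrite (leq_trans (size_poly_exp_leq _ _)) // ltnS -[leqRHS]mul1n.
  by rewrite leq_mul2r; case: (size l) sl => [|[|[]]] //=; rewrite orbT.
have s0 : (size (1 + 'X : {poly K})%R <= 2)%N.
  by rewrite addrC -polyC1 size_XaddC.
have s1 : (size (alpha *: (1 - 'X) : {poly K})%R <= 2)%N.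
  rewrite (leq_trans (size_scale_leq _ _)) // -size_polyN opprB.
  by rewrite -polyC1 size_XsubC.
have := leq_add (sl _ (n - m 1%R)%N s0) (sl _ (m 1%R) s1).
by have := homog_le Pn mP; lia.
Qed.

Lemma omega_frob (u v : 'F_p) :
  (u%:A + v%:A * alpha) ^+ p = u%:A - v%:A * alpha.
Proof. by rewrite frobK_D // exprMn !FpK_frob // alpha_frob mulrN. Qed.

Lemma omega2_neq0 (g : {'GL_2(p)}) : g \in torus a -> omega2 alpha g != 0.
Proof.
move=> Tg; apply: contraTneq (isT : true) => om0.
have := omega2M alpha2 Tg (groupVr Tg).
by rewrite mulgV omega2_1 // om0 mul0r => /eqP; rewrite oner_eq0.
Qed.

(** The torus multiplies v by omega and w by the p-th power of omega. *)
Lemma psi_torus n (g : {'GL_2(p)}) P : g \in torus a -> P \is n.-homog ->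
  psi (P \mPo GL_subst K g) =
  omega2 alpha g ^+ n *: (psi P \Po (omega2 alpha g ^+ p.-1 *: 'X)).
Proof.
move=> Tg Pn; have /torusP[u [v guv]] := Tg.
have omE := omega2E alpha guv; set om := omega2 alpha g in omE *.
have omp : om * om ^+ p.-1 = u%:A - v%:A * alpha.
  by rewrite -exprS prednK ?(ltnW p_gt1) // omE omega_frob.
rewrite /psi ev_subst -ev_comp -[RHS]mul_polyC polyC_exp -(ev_scale _ _ _ Pn).
rewrite /GL_entry guv !mxE /= comp_polyD comp_polyZ comp_polyB comp_polyX.
rewrite -!polyC1 !comp_polyC -!mul_polyC.
have ompC : om%:P * (om ^+ p.-1)%:P = (u%:A)%:P - (v%:A)%:P * alpha%:P.
  by rewrite -polyCM omp polyCB polyCM.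
have omC : om%:P = (u%:A)%:P + (v%:A)%:P * alpha%:P.
  by rewrite omE polyCD polyCM.
have vaC : ((v * a)%:A)%:P = (v%:A)%:P * (alpha%:P * alpha%:P).
  by rewrite -!polyCM -expr2 alpha2 -!in_algE rmorphM.
congr (ev _ _ P).
  transitivity (om%:P + om%:P * (om ^+ p.-1)%:P * 'X); last by ring.
  by rewrite ompC omC; ring.
transitivity (alpha%:P * (om%:P - om%:P * (om ^+ p.-1)%:P * 'X)); last by ring.
by rewrite ompC omC vaC; ring.
Qed.

Lemma coef_psi_torus n (g : {'GL_2(p)}) P j : g \in torus a -> P \is n.-homog ->
  (psi (P \mPo GL_subst K g))`_j =
  omega2 alpha g ^+ (n + p.-1 * j) * (psi P)`_j.
Proof.
move=> Tg Pn; rewrite (psi_torus Tg Pn) coefZ exprD -mulrA; congr (_ * _).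
rewrite exprM; move: (_ ^+ p.-1) (psi P) => w f.
rewrite comp_polyE coef_sum.
have [lt_jf|le_fj] := ltnP j (size f); last first.
  rewrite [f`_j]nth_default // mulr0 big1 // => i _.
  rewrite coefZ exprZn coefZ coefXn; case: eqP => [ej|_]; last by rewrite !mulr0.
  by have := ltn_ord i; rewrite -ej ltnNge le_fj.
rewrite (bigD1 (Ordinal lt_jf)) //= big1 ?addr0 => [|i /eqP ij].
  by rewrite coefZ exprZn coefZ coefXn eqxx mulr1 mulrC.
rewrite coefZ exprZn coefZ coefXn; case: eqP => [ej|_]; last by rewrite !mulr0.
by case: ij; apply: val_inj.
Qed.

Lemma coef_psi_theta n Q j : Q \is n.-homog ->
  (psi (theta Q))`_j = (psi Q)`_j.+1 *+ j.+1
    - (if (j <= p)%N then 0 else (psi Q)`_(j - p) *+ (j - p))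
    + (if (j < p)%N then 0 else (psi Q)`_(j - p) *+ n).
Proof.
move=> Qn; rewrite (psi_theta Qn) mulrBl mul1r !coefD coefN !coefXnM.
rewrite ltnS !coef_deriv -mulrA mulr_natl coefMn coefXnM.
congr (_ - _ + _); last by case: ifP; rewrite ?mul0rn.
by case: leqP => // lt_pj; rewrite -subSn // subSS.
Qed.

(** The coefficient of degree p - 1 in the derivative of a polynomial
vanishes in characteristic p, and the other terms start in degree p. *)
Lemma psi_theta_pred n Q : Q \is n.-homog -> (psi (theta Q))`_p.-1 = 0.
Proof.
move=> Qn; rewrite (coef_psi_theta _ Qn) prednK ?(ltnW p_gt1) //.
rewrite leq_pred leqnn // -mulr_natr (pcharf0 (pcharK K p_pr)).
by rewrite mulr0 subrr addr0.
Qed.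

(** Both coefficients see only the coefficient of degree 1 of psi Q. *)
Lemma psi_theta_succ n Q : (n < p)%N -> Q \is n.-homog ->
  (psi (theta Q))`_p.+1 = (n%:R - 1) * (psi (theta Q))`_0.
Proof.
move=> lt_np Qn; rewrite !(coef_psi_theta _ Qn) ltnn [(p.+1 < p)%N]ltnNge leqnSn /=.
rewrite nth_default; last by rewrite (leq_trans (size_psi Qn)) //; lia.
have -> : (p.+1 - p = 1)%N by lia.
have -> : (0 < p)%N = true by lia.
move: (psi Q)`_1 => x.
by rewrite mul0rn !mulr1n subr0 addr0 sub0r mulrBl mul1r mulr_natl addrC.
Qed.

End TorusPoint.

(** * Sums over the translates of a point *)

Section TranslateSums.
Variables (p : nat) (K : fieldExtType 'F_p).
Hypothesis p_pr : prime p.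

Let p_gt1 : (1 < p)%N := prime_gt1 p_pr.

Lemma sum_Fp_pow e : (e < p.-1)%N -> \sum_(b : 'F_p) b ^+ e = 0.
Proof.
move=> lt_ep; have [->|e_gt0] := posnP e.
  under eq_bigr do rewrite expr0.
  by rewrite sumr_const card_Fp // (pcharf0 (pchar_Fp p_pr)).
(* scaling by c multiplies the sum by its e-th power *)
have [c /andP[c0 ce]] : exists c : 'F_p, (c != 0) && (c ^+ e != 1).
  apply/existsP; apply: contraT => /existsPn noc.
  have X1 : 'X^e - 1 != 0 :> {poly 'F_p}.
    by rewrite -size_poly_eq0 -polyC1 size_XnsubC.
  have := max_poly_roots X1 (rs := enum [pred c : 'F_p | c != 0]).
  rewrite enum_uniq -polyC1 size_XnsubC // => /(_ _ isT).
  have -> : size (enum [pred c : 'F_p | c != 0]) = p.-1.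
    by rewrite -cardE cardC1 card_Fp.
  suff -> : all (root ('X^e - 1%:P)) (enum [pred c : 'F_p | c != 0]).
    by move=> /(_ isT); lia.
  apply/allP => c; rewrite mem_enum => /= c0; apply/rootP.
  have := noc c; rewrite [c != 0]c0 /= negbK => /eqP ce.
  by rewrite hornerD hornerN hornerXn hornerC ce subrr.
set s := \sum_b _; have: c ^+ e * s = s.
  rewrite /s mulr_sumr [in RHS](reindex_inj (mulfI c0)) /=.
  by apply: eq_bigr => b _; rewrite exprMn.
move/eqP; rewrite -subr_eq0 -{2}[s]mul1r -mulrBl mulf_eq0 subr_eq0 (negPf ce).
by move/eqP.
Qed.

Lemma sum_Fp_pow_pred : \sum_(b : 'F_p) b ^+ p.-1 = -1.
Proof.
rewrite (bigD1 0) //= expr0n -subn1 subn_eq0 leqNgt p_gt1 add0r.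
rewrite (eq_bigr (fun=> 1)) => [|b b0].
  rewrite sumr_const cardC1 card_Fp // -subn1 natrB 1?ltnW //.
  by rewrite (pcharf0 (pchar_Fp p_pr)) sub0r.
apply: (mulfI b0); rewrite subn1 -exprS prednK ?mulr1 1?ltnW //.
by have := expf_card b; rewrite card_Fp.
Qed.

Variables (y z : K).
Hypothesis y_frob : y ^+ p = y + z.

Lemma sum_translate_pow q : (q < p)%N ->
  \sum_(b : 'F_p) (y + b%:A) ^+ q = - (q == p.-1)%:R.
Proof.
move=> lt_qp; under eq_bigr do rewrite exprDn.
rewrite exchange_big /=.
transitivity (\sum_(i < q.+1) (y ^+ (q - i) *+ 'C(q, i)) *
     (\sum_(b : 'F_p) b ^+ i)%:A).
  apply: eq_bigr => i _; rewrite scaler_suml mulr_sumr; apply: eq_bigr => b _.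
  by rewrite mulrnAl -!in_algE rmorphXn.
have [eq_qp|ne_qp] := eqVneq q p.-1; last first.
  rewrite oppr0 big1 // => i _; rewrite sum_Fp_pow ?scale0r ?mulr0 //.
  by have := ltn_ord i; lia.
rewrite big_ord_recr big1 => [|i _] /=; last first.
  by rewrite sum_Fp_pow ?scale0r ?mulr0 // -eq_qp.
by rewrite add0r binn subnn eq_qp sum_Fp_pow_pred scaleNr scale1r expr0 mulr1n mul1r.
Qed.

(** The relation y^p = y + z, valid at all translates of y with the same
z, lowers exponents from p on. *)
Lemma sum_translate_pow2 q : (q < p.-1 + p.-1)%N ->
  \sum_(b : 'F_p) (y + b%:A) ^+ q = - (q == p.-1)%:R.
Proof.
move=> lt_q; have [/sum_translate_pow//|le_pq] := ltnP q p.
have -> : (q == p.-1) = false by lia.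
transitivity (\sum_(b : 'F_p) ((y + b%:A) ^+ (q - p).+1 + z * (y + b%:A) ^+ (q - p))).
  apply: eq_bigr => b _; rewrite -{1}(subnK le_pq) exprD frobK_D // y_frob FpK_frob //.
  by rewrite exprSr; ring.
rewrite big_split -mulr_sumr /= !sum_translate_pow; try lia.
have -> : ((q - p).+1 == p.-1) = false by lia.
have -> : (q - p == p.-1)%N = false by lia.
by rewrite oppr0 mulr0 addr0.
Qed.

Lemma sum_translate (Q : {poly K}) : (size Q <= p.-1 + p.-1)%N ->
  \sum_(b : 'F_p) Q.[y + b%:A] = - Q`_p.-1.
Proof.
move=> sQ; under eq_bigr do rewrite (horner_coef_wide _ sQ).
rewrite exchange_big /=.
transitivity (\sum_(i < p.-1 + p.-1) Q`_i * - (i == p.-1 :> nat)%:R).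
  by apply: eq_bigr => i _; rewrite -mulr_sumr sum_translate_pow2.
have lt_p : (p.-1 < p.-1 + p.-1)%N by lia.
rewrite (bigD1 (Ordinal lt_p)) //= eqxx mulrN1 big1 ?addr0 // => i ne_i.
by rewrite (_ : (i == p.-1 :> nat) = false) ?oppr0 ?mulr0 //; apply: negPf.
Qed.

(** The case w = z is the value at the conjugate point and the case w = 0
the value at the point itself. *)
Lemma sum_translate_spike e (w : K) : (e < p.-1)%N ->
  \sum_(b : 'F_p) (y + b%:A) ^+ e * (1 - (y + b%:A + w) ^+ p.-1) =
  'C(p.-1, e)%:R * w ^+ e.
Proof.
move=> lt_ep; pose Q : {poly K} := 'X^e * (1 - ('X + w%:P) ^+ p.-1).
have sQ : (size Q <= p.-1 + p.-1)%N.
  rewrite /Q (leq_trans (size_polyMleq _ _)) // size_polyXn addSn /=.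
  have sw : (size (1 - ('X + w%:P) ^+ p.-1)%R <= p)%N.
    rewrite (leq_trans (size_polyD _ _)) // geq_max size_poly1 size_polyN.
    rewrite (leq_trans (size_poly_exp_leq _ _)) ?size_XaddC ?mul1n; lia.
  by apply: leq_trans (leq_add (leqnn e) sw) _; lia.
transitivity (\sum_(b : 'F_p) Q.[y + b%:A]).
  by apply: eq_bigr => b _; rewrite /Q !hornerE.
rewrite (sum_translate sQ) /Q coefXnM ltnNge (ltnW lt_ep) /= coefB coef1.
rewrite subn_eq0 leqNgt lt_ep sub0r opprK addrC exprDn coef_sum.
have lt_pe : (p.-1 - e < p.-1.+1)%N by lia.
rewrite (bigD1 (Ordinal lt_pe)) //= big1 ?addr0 => [|i ne_i].
  rewrite -polyC_exp mul_polyC coefMn coefZ coefXn eqxx mulr1 subKn; last lia.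
  by rewrite bin_sub 1?ltnW // mulr_natl.
rewrite -polyC_exp mul_polyC coefMn coefZ coefXn; case: eqP => [ei|_].
  by case/negP: ne_i; apply/eqP/val_inj.
by rewrite mulr0 mul0rn.
Qed.

End TranslateSums.

Lemma coef_1X_exp (R : comNzRingType) m i :
  ((1 + 'X : {poly R}) ^+ m)`_i = 'C(m, i)%:R.
Proof.
rewrite addrC -(polyC1 R) exprDn coef_sum.
have [lt_im|le_mi] := ltnP i m.+1; last first.
  rewrite bin_small // big1 // => l _; rewrite -polyC_exp expr1n mulr1 coefMn.
  by rewrite coefXn; case: eqP => [e|_]; [have := ltn_ord l; lia | rewrite mul0rn].
have lt_mim : (m - i < m.+1)%N by lia.
rewrite (bigD1 (Ordinal lt_mim)) //= big1 ?addr0 => [|l ne_l].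
  by rewrite -polyC_exp expr1n mulr1 coefMn coefXn subKn // eqxx bin_sub.
rewrite -polyC_exp expr1n mulr1 coefMn coefXn; case: eqP => [e|_].
  by case/negP: ne_l; apply/eqP/val_inj => /=; have := ltn_ord l; lia.
by rewrite mul0rn.
Qed.

(** The case of a single carry of the Lucas congruence, read off from
(1 + T)^(p+k) = (1 + T^p)(1 + T)^k. *)
Lemma bin_pcharD p (K : fieldExtType 'F_p) k j : prime p ->
  'C(p + k, j)%:R = 'C(k, j)%:R + (if (p <= j)%N then 'C(k, j - p)%:R else 0) :> K.
Proof.
move=> p_pr; rewrite -coef_1X_exp exprD frobX_D // expr1n mulrDl mul1r coefD.
by rewrite coefXnM; case: ltnP; rewrite !coef_1X_exp.
Qed.

(** * The functional on the cokernel of D on a form of degree less than p *)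

Section Base.
Variables (p : nat) (K : fieldExtType 'F_p).
Hypotheses (p_pr : prime p) (p_odd : odd p).
Variables (alpha : K) (a : 'F_p).
Hypotheses (alphaN : alpha \notin 1%VS) (alpha2 : alpha ^+ 2 = a%:A).
Variable n : nat.
Hypotheses (n_gt0 : (0 < n)%N) (lt_np : (n < p)%N).
Implicit Types (P Q : {mpoly K[2]}).

Let p_gt1 : (1 < p)%N := prime_gt1 p_pr.
Local Notation D := (n + p.-1)%N.

(** On the points (1, t) with t in F_p this is the indicator function of
t = 0; its translates by the unipotent subgroup form a basis of V_(p-1). *)
Definition spike : {mpoly K[2]} := 'X_0 ^+ p.-1 - 'X_1 ^+ p.-1.

Lemma spike_homog : spike \is p.-1.-homog.
Proof.
apply: rpredB; first by have := dhomogXX K p.-1 0; rewrite expr0 mulr1 addn0.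
by have := dhomogXX K 0 p.-1; rewrite expr0 mul1r.
Qed.
Definition spike_form : dhomog 2 K p.-1 := DHomog spike_homog.

(** The translate of the line v + T w by the matrix (1 b; 0 d), see
evd_psi. *)
Definition evd (d b : 'F_p) : {mpoly K[2]} -> {poly K} :=
  ev (1 + 'X) ((d%:A * alpha + b%:A)%:P + (b%:A - d%:A * alpha) *: 'X).
HB.instance Definition _ d b := GRing.RMorphism.on (evd d b).
HB.instance Definition _ d b := GRing.Linear.on (evd d b).

(** The functional on (V_(n+p-1) / D V_n) tensor V_(p-1), moved by
(1 b; 0 d) and evaluated at P tensor the spike. The two factors on the left are
torus eigenvectors that kill D V_n, and the two terms have the same weight. The
first term detects the monomials X^i Y^J with J >= n and the second those with
J < n; the relative weight alpha is outside the prime field, which keeps them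
from cancelling. *)
Definition pairing d b P : K :=
  (evd d b P)`_p.-1 * (evd d b spike)`_0 +
  alpha * ((evd d b P)`_p.+1 - (n%:R - 1) * (evd d b P)`_0) * (evd d b spike)`_p.-1.

Fact pairing_is_linear d b : linear (pairing d b : {mpoly K[2]} -> K^o).
Proof.
move=> c P Q; rewrite /pairing linearP !coefD !coefZ /GRing.scale /=; ring.
Qed.
HB.instance Definition _ d b := GRing.isLinear.Build K {mpoly K[2]} K^o _
  (pairing d b) (pairing_is_linear d b).

Let y (d : 'F_p) : K := d%:A * alpha.
Let z (d : 'F_p) : K := - (2%:R * y d).

Let y_frob d : y d ^+ p = y d + z d.
Proof.
by rewrite /z /y exprMn (alpha_frob p_pr alphaN alpha2) FpK_frob //; ring.
Qed.

Let mono J : {mpoly K[2]} := 'X_0 ^+ (D - J) * 'X_1 ^+ J.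

Lemma evdE d b : evd d b =
  ev (1 + 'X) ((y d + b%:A) *: (1 + 'X) + z d *: 'X).
Proof.
rewrite /evd; congr ev; rewrite scalerDr -addrA -scalerDl alg_polyC.
by congr (_ + _ *: _); rewrite /z /y; ring.
Qed.

Lemma coef_evd_mono d b J j : (J <= D)%N -> (J <= j)%N -> (evd d b (mono J))`_j =
  \sum_(l < J.+1) (y d + b%:A) ^+ (J - l) * z d ^+ l * ('C(J, l) * 'C(D - l, j - l))%:R.
Proof.
move=> le_JD le_Jj; rewrite evdE rmorphM !rmorphXn /= ev0 ev1.
rewrite [X in _ * X]exprDn mulr_sumr coef_sum.
apply: eq_bigr => l _; have le_lJ := leq_ord l.
pose c := (y d + b%:A) ^+ (J - l) * z d ^+ l * 'C(J, l)%:R.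
transitivity ((c%:P * ('X^l * (1 + 'X) ^+ (D - l)))`_j).
  rewrite !exprZn; apply: (congr1 (fun f : {poly K} => f`_j)).
  have -> : (D - l = (D - J) + (J - l))%N by lia.
  by rewrite exprD -!mul_polyC /c !polyCM polyC_natr -mulr_natr; ring.
rewrite mul_polyC coefZ coefXnM ltnNge (leq_trans le_lJ le_Jj) /=.
by rewrite coef_1X_exp /c natrM mulrA.
Qed.

Lemma coef0_evd_mono d b J : (evd d b (mono J))`_0 = (y d + b%:A) ^+ J.
Proof.
rewrite evdE rmorphM !rmorphXn /= ev0 ev1 -horner_coef0 hornerM !horner_exp.
by rewrite !hornerE /= expr1n mul1r.
Qed.

Lemma coef0_evd_spike d b : (evd d b spike)`_0 = 1 - (y d + b%:A + 0) ^+ p.-1.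
Proof.
rewrite evdE rmorphB !rmorphXn /= ev0 ev1 -horner_coef0 hornerD hornerN.
by rewrite !horner_exp !hornerE /= expr1n.
Qed.

Lemma coefp_evd_spike d b :
  (evd d b spike)`_p.-1 = 1 - (y d + b%:A + z d) ^+ p.-1.
Proof.
rewrite rmorphB !rmorphXn /= /evd ev0 ev1 coefB coef_1X_exp binn; congr (_ - _).
rewrite exprDn coef_sum (bigD1 ord_max) //= big1 ?addr0 => [|i ne_i].
  rewrite subnn expr0 mul1r exprZn binn mulr1n coefZ coefXn eqxx mulr1.
  by congr (_ ^+ _); rewrite /z /y; ring.
rewrite -polyC_exp exprZn mul_polyC coefMn !coefZ coefXn; case: eqP => [ei|_].
  by case/negP: ne_i; apply/eqP/val_inj.
by rewrite !mulr0 mul0rn.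
Qed.

(** The contribution of the second term of the pairing to the monomial of
index J, an integer by pairing_mono. *)
Definition base_mult J : nat :=
  \sum_(l < J) 'C(J, l.+1) * 'C(D - l.+1, p - l) * 'C(p.-1, J - l.+1).
Definition base_coef J : K := 'C(D - J, p.-1 - J)%:R + alpha * (base_mult J)%:R.

(** In the coordinates y + b and z, where z does not depend on b, each
coefficient of the evaluated monomial is a combination of z^l (y+b)^(J-l), to which
sum_translate_spike applies. *)
Lemma pairing_mono d J : (0 < J < p)%N ->
  \sum_(b : 'F_p) pairing d b (mono J) = base_coef J * z d ^+ J.
Proof.
move=> /andP[J_gt0 lt_Jp]; rewrite /base_coef mulrDl.
have yz := y_frob d.
have De : D = (p + n.-1)%N by lia.
have C1 : 'C(D, p.-1)%:R = 0 :> K.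
  rewrite De bin_pcharD // bin_small ?add0r; last by lia.
  by rewrite leqNgt ltn_predL ltnW.
have C2 : 'C(D, p.+1)%:R = n%:R - 1 :> K.
  rewrite De bin_pcharD // leqnSn bin_small ?add0r; last by lia.
  by rewrite subSn // subnn bin1 -subn1 natrB.
rewrite big_split /=; congr (_ + _).
  pose c l := z d ^+ l * ('C(J, l) * 'C(D - l, p.-1 - l))%:R.
  transitivity (\sum_(b : 'F_p) \sum_(l < J.+1) c l *
      ((y d + b%:A) ^+ (J - l) * (1 - (y d + b%:A + 0) ^+ p.-1))).
    apply: eq_bigr => b _; rewrite coef0_evd_spike coef_evd_mono; try lia.
    by rewrite mulr_suml; apply: eq_bigr => l _; rewrite /c; ring.
  rewrite exchange_big /= (bigD1 ord_max) //= [X in _ + X]big1 => [|l ne_lJ].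
    rewrite addr0 -mulr_sumr subnn (sum_translate_spike p_pr yz); last by lia.
    by rewrite bin0 expr0 mulr1 mulr1 /c binn mul1n mulrC.
  have lt_lJ : (l < J)%N.
    by rewrite ltn_neqAle leq_ord andbT; apply: contraNneq ne_lJ => e; apply/eqP/val_inj.
  (* the exponent J - 0 may reach p - 1, but this term is zero modulo p *)
  rewrite -mulr_sumr; have [l0|l_gt0] := posnP l.
    by rewrite /c l0 bin0 mul1n !subn0 C1 mulr0 mul0r.
  rewrite (sum_translate_spike p_pr yz); last by lia.
  by rewrite expr0n subn_eq0 leqNgt lt_lJ !mulr0.
pose c l := z d ^+ l * ('C(J, l) * 'C(D - l, p.+1 - l))%:R.
transitivity (\sum_(b : 'F_p) \sum_(l < J) alpha * c l.+1 *
    ((y d + b%:A) ^+ (J - l.+1) * (1 - (y d + b%:A + z d) ^+ p.-1))).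
  apply: eq_bigr => b _; rewrite coefp_evd_spike coef0_evd_mono coef_evd_mono; try lia.
  (* the multiple of the constant coefficient was chosen to cancel the term l = 0 *)
  rewrite big_ord_recl /= !subn0 bin0 mul1n C2 expr0 mulr1 [X in X - _]addrC.
  rewrite [_ ^+ J * _]mulrC addrK mulr_sumr mulr_suml; apply: eq_bigr => l _.
  by rewrite /c; ring.
rewrite exchange_big /= /base_mult natr_sum mulr_sumr mulr_suml.
apply: eq_bigr => l _; rewrite -mulr_sumr (sum_translate_spike p_pr yz); last by lia.
have -> : z d ^+ J = z d ^+ l.+1 * z d ^+ (J - l.+1).
  by rewrite -exprD; congr (_ ^+ _); have := ltn_ord l; lia.
by rewrite /c !natrM subSS; ring.
Qed.

(** The two integers are not both divisible by p, and 1 and alpha are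
independent over the prime field. For J >= n the first one is a binomial
coefficient of a number less than p; for J < n only the term l = 0 of base_mult
survives modulo p, and it is J times such a coefficient. *)
Lemma base_coef_neq0 J : (0 < J < p)%N -> base_coef J != 0.
Proof.
have ndvd k : (k < p)%N -> ~~ (p %| k`!)%N.
  elim: k => [|k IHk] lt_kp; first by rewrite fact0 gtnNdvd.
  by rewrite factS Euclid_dvdM // negb_or gtnNdvd // IHk // ltnW.
have bin_neq0 N k : (k <= N)%N -> (N < p)%N -> ~~ (p %| 'C(N, k))%N.
  move=> le_kN lt_Np; apply: contra (ndvd _ lt_Np) => dvd_b.
  by rewrite -(bin_fact le_kN) dvdn_mulr.
move=> /andP[J_gt0 lt_Jp]; apply/eqP => e.
have [|] := @alg_alpha_inj p K alpha ('C(D - J, p.-1 - J)%:R) (base_mult J)%:R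
  0 0 alphaN.
  rewrite !scale0r mul0r addr0 -[RHS]e /base_coef -!in_algE !rmorph_nat.
  by rewrite [alpha * _]mulrC.
move=> /eqP c1 /eqP c2; have [le_nJ|lt_Jn] := leqP n J.
  move: c1; rewrite -(dvdn_pcharf (pchar_Fp p_pr)).
  by apply/negP/bin_neq0; lia.
move: c2; rewrite -(dvdn_pcharf (pchar_Fp p_pr)) (dvdn_pcharf (pcharK K p_pr)).
apply/negP; rewrite /base_mult; case: J J_gt0 lt_Jp lt_Jn {e c1} => // J _ lt_Jp lt_Jn.
rewrite big_ord_recl natrD natr_sum big1 ?addr0 => [|l _].
  rewrite /= !natrM bin1 subn0 (_ : (D - 1 = p + (n - 2))%N); last by lia.
  rewrite bin_pcharD // leqnn subnn bin0 bin_small ?add0r ?mulr1; last by lia.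
  rewrite -natrM -(dvdn_pcharf (pcharK K p_pr)) Euclid_dvdM // negb_or.
  by rewrite gtnNdvd //= bin_neq0 //; lia.
rewrite lift0 !natrM; have := ltn_ord l => lt_lJ.
rewrite (_ : (D - l.+2 = p + (n - l.+3))%N); last by lia.
rewrite bin_pcharD // (@bin_small (n - l.+3)); last by lia.
by rewrite ifF ?addr0 ?mulr0 ?mul0r //; lia.
Qed.

(** Write f = tau g + r in the affine chart. An antiderivative q of g, which
exists because g has degree less than n < p, gives D q = n q + tau g, and the free
constant of q clears the constant coefficient of r - n q. *)
Lemma mod_theta P : P \is (n + p.-1).-homog -> exists Q (c : nat -> K),
  Q \is n.-homog /\ P = theta Q + \sum_(1 <= J < p) c J *: mono J.
Proof.
move=> Ph; pose f := ev 1 'X P; pose t := tau K.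
have t0 : t != 0 by apply: tau_neq0.
have natn0 k : (0 < k < p)%N -> k%:R != 0 :> K.
  by move=> /andP[k0 kp]; rewrite natK_eq0 // gtnNdvd.
pose g := f %/ t; pose r := f %% t.
have sr : (size r <= p)%N by rewrite -ltnS -(size_tau K p_pr) ltn_modp.
have sg : (size g <= n)%N.
  rewrite /g size_divp // size_tau //= leq_subLR (leq_trans (size_eta Ph)) //.
  by lia.
pose q : {poly K} := \poly_(i < n.+1)
  (if i is i'.+1 then g`_i' / i%:R else r`_0 / n%:R).
have dq : q^`() = g.
  apply/polyP => i; rewrite coef_deriv coef_poly ltnS; case: ltnP => [lt_in|le_ni].
    by rewrite /= -[RHS](@divfK _ i.+1%:R) ?mulr_natr // natn0 //; lia.
  by rewrite mul0rn nth_default // (leq_trans sg).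
have [Q Qh eQ] := eta_surj (size_poly _ _ : (size q <= n.+1)%N).
pose s := r - n%:R *: q.
have ss : (size s <= p)%N.
  rewrite (leq_trans (size_polyD _ _)) // geq_max sr size_polyN.
  rewrite (leq_trans (size_scale_leq _ _)) // (leq_trans (size_poly _ _)) //.
exists Q, (fun J => s`_J); split=> //.
have mh J : (0 < J < p)%N -> mono J \is (n + p.-1).-homog.
  move=> J_lt; have := dhomogXX K (D - J) J; rewrite subnK //; lia.
apply: (eta_inj2 Ph).
  apply: rpredD; first exact: theta_homog.
  rewrite big_nat; apply: rpred_sum => J /mh; exact: rpredZ.
rewrite rmorphD rmorph_sum /=.
rewrite (eta_theta Qh) eQ dq -/f {1}(divp_eq f t) -/g -/r.
have -> : \sum_(1 <= J < p) ev 1 'X (s`_J *: mono J) = s.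
  apply/polyP => i; rewrite coef_sum.
  under eq_bigr => J _ do
    rewrite evZ rmorphM !rmorphXn /= ev0 ev1 expr1n mul1r coefZ coefXn.
  have [i_lt|i_nlt] := boolP (0 < i < p)%N.
    rewrite (bigD1_seq i) ?iota_uniq ?mem_index_iota //= eqxx mulr1.
    by rewrite big1 ?addr0 // => J; rewrite eq_sym => /negPf->; rewrite mulr0.
  rewrite big_nat big1 => [|J J_lt]; last first.
    by case: eqP => [eJ|_]; [rewrite eJ J_lt in i_nlt | rewrite mulr0].
  have [i0|i_gt0] := posnP i.
    by rewrite i0 /s coefB coefZ coef_poly /= mulrC divfK ?subrr // natn0 // n_gt0.
  by rewrite nth_default // (leq_trans ss) //; lia.
have nq : n%:R *: q = n%:R * q by rewrite -polyC_natr mul_polyC.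
by rewrite /s nq -/t; ring.
Qed.

Lemma evd_psi (g : {'GL_2(p)}) d b P : GL_entry g 0 0 = 1 -> GL_entry g 0 1 = b ->
    GL_entry g 1 0 = 0 -> GL_entry g 1 1 = d ->
  psi alpha (P \mPo GL_subst K g) = evd d b P.
Proof.
move=> g00 g01 g10 g11; rewrite /psi ev_subst g00 g01 g10 g11 /evd.
congr (ev _ _ P); first by rewrite !scale1r !scale0r addr0.
by rewrite -!mul_polyC polyCD polyCB !polyCM; ring.
Qed.

Lemma pairing_theta (g : {'GL_2(p)}) d b Q :
    GL_entry g 0 0 = 1 -> GL_entry g 0 1 = b ->
    GL_entry g 1 0 = 0 -> GL_entry g 1 1 = d ->
  Q \is n.-homog -> pairing d b (theta Q) = 0.
Proof.
move=> g00 g01 g10 g11 Qh; rewrite /pairing -!(evd_psi _ g00 g01 g10 g11).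
rewrite -theta_subst //; have gQh := GL_subst_homog g Qh.
rewrite (psi_theta_pred p_pr p_odd alphaN alpha2 gQh) mul0r add0r.
by rewrite (psi_theta_succ p_pr p_odd alphaN alpha2 lt_np gQh) subrr mulr0 mul0r.
Qed.

(** By pairing_mono the hypothesis says that a polynomial of degree less
than p vanishes at all d in F_p, once the root d = 0 is added. *)
Lemma sum_pairing_eq0 P : P \is (n + p.-1).-homog ->
    (forall Q d b, d != 0 -> Q \is n.-homog -> pairing d b (theta Q) = 0) ->
    (forall d, d != 0 -> \sum_(b : 'F_p) pairing d b P = 0) ->
  exists2 Q, Q \is n.-homog & P = theta Q.
Proof.
move=> Ph pt0 sum0; have [Q [c [Qh eP]]] := mod_theta Ph; exists Q => //.
rewrite eP [X in _ + X]big_nat big1 ?addr0 // => J J_lt.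
pose zeta := - (2%:R * alpha).
have zE d : z d = d%:A * zeta by rewrite /z /y /zeta; ring.
have zeta0 : zeta != 0.
  rewrite oppr_eq0 mulf_neq0 ?(alpha_neq0 alphaN) // natK_eq0 // gtnNdvd //.
  by move: p_odd p_gt1; case: (p) => [|[|[|]]].
pose h : {poly K} := \poly_(J < p)
  (if J == 0%N then 0 else c J * base_coef J * zeta ^+ J).
have h0 : h = 0.
  apply/eqP; apply: contraT => h_neq0.
  have := max_poly_roots h_neq0 (rs := [seq (d%:A : K) | d <- enum 'F_p]).
  rewrite map_inj_uniq ?enum_uniq; last exact: (fmorph_inj (in_alg K)).
  rewrite size_map -cardE card_Fp // [(p < _)%N]ltnNge size_poly.
  suff -> : all (root h) [seq (d%:A : K) | d <- enum 'F_p] by move=> /(_ isT isT).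
  apply/allP => _ /mapP[d _ ->]; apply/rootP; rewrite horner_poly.
  have [->|d0] := eqVneq d 0.
    rewrite big1 // => i _; case: eqP => [_|/eqP i0]; first by rewrite mul0r.
    by rewrite scale0r expr0n (negPf i0) mulr0.
  rewrite -(big_mkord xpredT (fun i =>
    (if i == 0%N then 0 else c i * base_coef i * zeta ^+ i) * (d%:A : K) ^+ i)).
  rewrite big_ltn ?(ltnW p_gt1) //= mul0r add0r.
  rewrite -[RHS](sum0 d d0) eP.
  under [RHS]eq_bigr => b _ do rewrite linearD /= pt0 // add0r linear_sum.
  rewrite exchange_big /=; apply: eq_big_nat => i i_lt.
  rewrite [RHS](eq_bigr (fun b => c i * pairing d b (mono i))) => [|b _]; last first.
    by rewrite linearZ.
  rewrite -mulr_sumr pairing_mono // zE ifF; last by lia.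
  by rewrite exprMn /GRing.scale /=; ring.
have /polyP/(_ J) := h0; rewrite coef_poly coef0; have [J_gt0 lt_Jp] := andP J_lt.
rewrite lt_Jp ifF; last by lia.
move/eqP; rewrite !mulf_eq0 (negPf (base_coef_neq0 J_lt)) orbF expf_eq0.
by rewrite (negPf zeta0) andbF orbF => /eqP->; rewrite scale0r.
Qed.

End Base.

(** * Generalities on representations *)

Section Generalities.
Variables (K : fieldType) (gT : finGroupType).
Local Open Scope group_scope.

(** The average over T of the twisted translates of lam; it does not move
the values at which lam is already an eigenvector. *)
Lemma eigen_average (T : {group gT}) (V : rep K T) (chi : gT -> K)
    (lam : 'Hom(V, K^o)) :
    (#|T|%:R != 0 :> K)%R -> {in T &, {morph chi : s t / s * t >-> (s * t)%R}} ->
    {in T, forall t, chi t != 0%R} ->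
  exists lam' : 'Hom(V, K^o),
    {in T, forall t v, lam' (rep_act V t v) = (chi t * lam' v)%R} /\
    forall v c, {in T, forall t, lam (rep_act V t v) = (chi t * c)%R} -> lam' v = c.
Proof.
move=> T0 chiM chi0.
pose lam' : 'Hom(V, K^o) := (#|T|%:R^-1 *: \sum_(t in T)
  (chi t)^-1 *: (lam \o rep_act V t)%VF)%R.
have lamE v : (lam' v = #|T|%:R^-1 * \sum_(t in T) (chi t)^-1 * lam (rep_act V t v))%R.
  rewrite scale_lfunE sum_lfunE; congr (_ * _)%R; apply: eq_bigr => t _.
  by rewrite scale_lfunE comp_lfunE.
exists lam'; split=> [s Ts v|v c lamv].
  rewrite !lamE mulrCA; congr (_ * _)%R.
  rewrite mulr_sumr [RHS](reindex_inj (mulIg s)) /=.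
  rewrite [RHS](eq_bigl (fun t => t \in T)) => [|t]; last by rewrite /= groupMr.
  apply: eq_bigr => t Tt; rewrite chiM // invfM rep_actM // comp_lfunE.
  by rewrite mulrCA !mulrA divfK ?chi0 // mulrC.
rewrite lamE (eq_bigr (fun=> c)) => [|t Tt]; last first.
  by rewrite lamv // mulrA mulVf ?mul1r ?chi0.
by rewrite sumr_const -[(c *+ _)%R]mulr_natl mulrA mulVf // mul1r.
Qed.

Lemma lker0_bij (V W : vectType K) (f : 'Hom(V, W)) :
  lker f = 0%VS -> (dim W <= dim V)%N -> bijective f.
Proof.
move=> f0 le_WV; have finj : lker f == 0%VS by apply/eqP.
exists (f^-1)%VF; first exact: lker0_lfunK.
move=> w; apply: limg_lfunVK.
suff -> : limg f = fullv by apply: memvf.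
apply/eqP; rewrite eqEdim subvf /= limg_dim_eq ?f0 ?capv0 //.
by rewrite !dimvf.
Qed.

(** Frobenius reciprocity. *)
Lemma ind_hom (H : {group gT}) (M : rep K [set: gT]) (W : rep K H)
    (phi : 'Hom(M, W)) :
    {in H, forall t x, phi (rep_act M t x) = rep_act W t (phi x)} ->
  exists Phi : 'Hom(M, ind_rep W),
    (forall g x, Phi (rep_act M g x) = rep_act (ind_rep W) g (Phi x)) /\
    (forall x g, vsval (Phi x : subvs_of (ind_space W)) g = phi (rep_act M g x)).
Proof.
move=> phiH.
pose F (x : M) : subvs_of (ind_space W) :=
  vsproj (ind_space W) [ffun g => phi (rep_act M g x)].
have FE x g : vsval (F x) g = phi (rep_act M g x).
  rewrite /F vsprojK ?ffunE //; apply/ind_spaceP => t Ht h.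
  by rewrite !ffunE rep_actM ?inE // comp_lfunE phiH.
have Flin : linear F.
  move=> c x y; apply/val_inj/ffunP => g.
  have -> : (vsval (c *: F x + F y) g = c *: vsval (F x) g + vsval (F y) g)%R.
    by rewrite linearP !ffunE.
  by rewrite [LHS]FE !FE !linearP.
pose FL : {linear M -> subvs_of (ind_space W)} :=
  HB.pack F (GRing.isLinear.Build K M (subvs_of (ind_space W)) _ F Flin).
have PE x : linfun FL x = F x by rewrite lfunE.
exists (linfun FL); split=> [g x|x g]; rewrite !PE ?FE //.
apply/val_inj/ffunP => h.
by rewrite [LHS]FE [RHS]ind_actE FE rep_actM ?inE // comp_lfunE.
Qed.

(** A function in the induced space is determined by its values on a
transversal of H. *)
Lemma dim_ind_space (H : {group gT}) (W : rep K H) :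
  (\dim (ind_space W) <= #|[set: gT] : H| * dim W)%N.
Proof.
set n := #|[set: gT] : H|.
pose r (i : 'I_n) : gT := repr (enum_val i).
pose R (f : {ffun gT -> W}) : {ffun 'I_n -> W} := [ffun i => f (r i)].
have Rlin : linear R by move=> c f f'; apply/ffunP=> i; rewrite !ffunE.
pose RL : {linear {ffun gT -> W} -> {ffun 'I_n -> W}} :=
  HB.pack R (GRing.isLinear.Build K {ffun gT -> W} {ffun 'I_n -> W} _ R Rlin).
rewrite -(@limg_dim_eq _ _ _ (linfun RL)).
  apply: (leq_trans (dimvS (subvf _))); rewrite dimvf.
  by rewrite leq_mul2r card_ord leqnn orbT.
apply/eqP; rewrite -subv0; apply/subvP => f; rewrite memv_cap memv_ker.
move=> /andP[/ind_spaceP fI]; rewrite lfunE /= memv0 => /eqP/ffunP Rf0.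
apply/eqP/ffunP => g; rewrite [RHS]ffunE.
have gC : H :* g \in rcosets H [set: gT] by apply/rcosetsP; exists g; rewrite ?inE.
have := Rf0 (enum_rank_in gC (H :* g)); rewrite !ffunE /r enum_rankK_in //.
case: repr_rcosetP => h Hh fg0.
rewrite -(mulKg h g); apply: etrans (fI _ (groupVr Hh) _) _.
exact: etrans (congr1 _ fg0) (linear0 _).
Qed.

End Generalities.

Lemma functional_ext (K : fieldType) (V1 V2 V3 : vectType K)
    (f : 'Hom(V1, V2)) (h : 'Hom(V3, V2)) (lam : 'Hom(V1, K^o)) :
    (forall x y, f x = h y -> lam x = 0) ->
  exists lam0 : 'Hom(V2, K^o), (forall x, lam0 (f x) = lam x) /\
    (forall y, lam0 (h y) = 0).
Proof.
move=> fh; pose q : 'End(V2) := (\1 - projv (limg h))%VF.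
have qh y : q (h y) = 0.
  by rewrite add_lfunE opp_lfunE id_lfunE projv_id ?subrr // memv_img ?memvf.
have qf x : q x = 0 -> x \in limg h.
  rewrite add_lfunE opp_lfunE id_lfunE => /eqP; rewrite subr_eq0 => /eqP->.
  exact: memv_proj.
exists (lam \o (q \o f)^-1 \o q)%VF; split=> [x|y]; last first.
  by rewrite !comp_lfunE qh !linear0.
rewrite !comp_lfunE; apply/eqP; rewrite -subr_eq0 -linearB; apply/eqP.
set w := (q \o f)^-1%VF _.
have : q (f w) = q (f x).
  have -> : q (f w) = (q \o f)%VF w by rewrite comp_lfunE.
  by rewrite limg_lfunVK // -comp_lfunE memv_img ?memvf.
move/eqP; rewrite -subr_eq0 -linearB => /eqP/qf.
rewrite -linearB => /memv_imgP[y' _ /fh]; exact.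
Qed.

Lemma vquot_functional (K : fieldType) (X : vectType K) (Y : {vspace X})
    (lam : 'Hom(X, K^o)) :
    (forall x, x \in Y -> lam x = 0) ->
  exists lamq : 'Hom(vquot Y, K^o), forall x, lamq (vquot_pi Y x) = lam x.
Proof.
move=> lam0; pose q := linfun (vquot_pi Y).
exists (lam \o q^-1)%VF => x; rewrite comp_lfunE; apply/eqP.
rewrite -[vquot_pi Y x]lfunE -subr_eq0 -linearB; apply/eqP/lam0/vquot_pi_eq.
have : q (q^-1%VF (q x)) = q x by rewrite limg_lfunVK // memv_img ?memvf.
by rewrite /q !lfunE.
Qed.

Lemma lformP (K : fieldType) (X : vectType K) (f : 'Hom(X, K^o)) d x y :
  f (d *: x + y) = d * f x + f y :> K.
Proof. by rewrite linearP. Qed.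

Lemma lformZ (K : fieldType) (X : vectType K) (f : 'Hom(X, K^o)) d x :
  f (d *: x) = d * f x :> K.
Proof. by rewrite linearZ. Qed.

Lemma tens_act_apply (K : fieldType) (gT : finGroupType) (G : {group gT})
    (X Y : rep K G) g (x : tensor X Y) lam :
  (rep_act (tens_rep X Y) g x : tensor X Y) lam =
  rep_act Y g (x (lam \o rep_act X g)%VF).
Proof. by rewrite [LHS]/= /tens_act lfunE /= !comp_lfunE lfunE. Qed.

Lemma rep_actMv (K : fieldType) (gT : finGroupType) (X : rep K [set: gT]) g h v :
  rep_act X g (rep_act X h v) = rep_act X (g * h)%g v.
Proof. by rewrite rep_actM ?inE // comp_lfunE. Qed.

(** A tensor is a map from the dual of X to Y, so q tensor f sends x to
f (x q). The second clause evaluates the form at a tensor given as a sum of pure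
tensors. *)
Lemma tens_form (K : fieldType) (gT : finGroupType) (G : {group gT})
    (X Y : rep K G) (q1 q2 : 'Hom(X, K^o)) (f1 f2 : 'Hom(Y, K^o)) (c : K) :
  exists B : 'Hom(tens_rep X Y, K^o),
    (forall g k1 k2 j1 j2,
       (forall y, q1 (rep_act X g y) = k1 * q1 y) ->
       (forall y, q2 (rep_act X g y) = k2 * q2 y) ->
       (forall z, f1 (rep_act Y g z) = j1 * f1 z) ->
       (forall z, f2 (rep_act Y g z) = j2 * f2 z) ->
       k1 * j1 = k2 * j2 ->
     forall x, B (rep_act (tens_rep X Y) g x) = k1 * j1 * B x) /\
    (forall g (I : finType) (ys : I -> X) (zs : I -> Y) (x : tens_rep X Y),
       (forall lam : 'Hom(X, K^o),
          (x : tensor X Y) lam = \sum_i (lam (ys i) : K) *: zs i) ->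
     B (rep_act (tens_rep X Y) g x) =
       \sum_i (q1 (rep_act X g (ys i)) * f1 (rep_act Y g (zs i)) +
         c * q2 (rep_act X g (ys i)) * f2 (rep_act Y g (zs i)))).
Proof.
have sE (u : K) (v : K^o) : u *: v = u * v by [].
pose F (x : tensor X Y) : K^o := f1 (x q1) + c * f2 (x q2).
have Flin : linear F.
  move=> d x y; rewrite /F !add_lfunE !scale_lfunE !lformP.
  by rewrite !sE; ring.
pose FL : {linear tensor X Y -> K^o} :=
  HB.pack F (GRing.isLinear.Build K (tensor X Y) K^o _ F Flin).
have FE x : linfun FL x = F x by rewrite lfunE.
have qg (q : 'Hom(X, K^o)) g k : (forall y, q (rep_act X g y) = k * q y) ->
    (q \o rep_act X g)%VF = k *: q.
  by move=> qk; apply/lfunP => y; rewrite comp_lfunE qk scale_lfunE.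
have lfZ (S T : vectType K) (f : 'Hom(S, T)) k v : f (k *: v) = k *: f v.
  exact: linearZ.
exists (linfun FL); split=> [g k1 k2 j1 j2 q1g q2g f1g f2g kj x|g I ys zs x xE].
  rewrite !FE /F !tens_act_apply (qg _ _ _ q1g) (qg _ _ _ q2g) !lfZ !sE.
  rewrite f1g f2g mulrDr [X in _ + X]mulrCA {2}kj; ring.
rewrite FE /F !tens_act_apply !xE !linear_sum mulr_sumr -big_split /=.
apply: eq_bigr => i _; rewrite !comp_lfunE !linearZ /= !sE; ring.
Qed.

(** The k-th moment of the orbit of x is the sum of the b^k u_b x. Translating
by u_c changes it by a combination of lower moments, so the first nonzero moment is
invariant; the moments of order 0 and p - 1 differ by x, hence are not both zero. *)
Lemma unipotent_fixed (p : nat) (K : fieldExtType 'F_p) (V : vectType K)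
    (u : 'F_p -> 'End(V)) (S : {vspace V}) :
    prime p -> (forall v, u 0 v = v) -> (forall b c v, u (b + c) v = u b (u c v)) ->
    (forall b v, v \in S -> u b v \in S) ->
  S <> 0%VS -> exists x, [/\ x \in S, x != 0 & forall b, u b x = x].
Proof.
move=> p_pr u0 uD uS /eqP S0.
have [x [Sx x0]] : exists x, x \in S /\ x != 0.
  by exists (vpick S); rewrite memv_pick vpick0.
pose N k := \sum_(b : 'F_p) (b%:A ^+ k : K) *: u b x.
have NS k : N k \in S by apply: rpred_sum => b _; rewrite rpredZ ?uS.
have [k Nk0 Nmin] : exists2 k, N k != 0 & forall j, (j < k)%N -> N j = 0.
  suff exN : exists k, N k != 0.
    exists (ex_minn exN); first by case: ex_minnP.
    by case: ex_minnP => k _ kmin j; apply: contraTeq => /kmin; rewrite -leqNgt.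
  have [N0|N0] := eqVneq (N 0%N) 0; last by exists 0%N.
  exists p.-1; apply: contraNneq x0 => Np.
  have : N 0%N - N p.-1 = x.
    rewrite /N -sumrB (bigD1 0) //= big1 => [|b b0].
      rewrite addr0 u0 scale0r expr0 [0 ^+ p.-1]expr0n.
      by rewrite -subn1 subn_eq0 leqNgt prime_gt1 //= scale1r scale0r subr0.
    rewrite -scalerBl -!in_algE -!rmorphXn expr0 /=.
    rewrite (_ : b ^+ p.-1 = 1) ?subrr ?scale0r //.
    apply: (mulfI b0); rewrite -exprS prednK ?prime_gt0 // mulr1.
    by have := expf_card b; rewrite card_Fp.
  by rewrite N0 Np subr0 => <-.
exists (N k); split=> // c.
rewrite {1}/N linear_sum /=.
rewrite (eq_bigr (fun b => (((c + b) - c)%:A ^+ k : K) *: u (c + b) x)) => [|b _];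
  last first.
  by rewrite linearZ /= -uD [c + b - c]addrAC subrr add0r.
rewrite -(reindex_inj (addrI c) (P := xpredT)
  (F := fun b => ((b - c)%:A ^+ k : K) *: u b x)) /=.
under eq_bigr do rewrite scalerBl exprBn scaler_suml.
rewrite exchange_big big_ord_recl /= [X in _ + X]big1 ?addr0.
  by apply: eq_bigr => b _; rewrite subn0 !expr0 mulr1 mul1r bin0 mulr1n.
move=> i _.
transitivity (((-1) ^+ lift ord0 i * c%:A ^+ lift ord0 i *+ 'C(k, lift ord0 i)) *:
   N (k - lift ord0 i)%N); last first.
  by rewrite Nmin ?scaler0 // lift0; have := ltn_ord i; lia.
rewrite /N scaler_sumr; apply: eq_bigr => b _; rewrite scalerA; congr (_ *: _).
by rewrite mulrnAl mulrAC.
Qed.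

(** * Torus-equivariant functionals *)

Section Torus.
Variables (p : nat) (K : fieldExtType 'F_p).
Hypothesis p_pr : prime p.
Variables (alpha : K) (a : 'F_p).
Hypotheses (alphaN : alpha \notin 1%VS) (alpha2 : alpha ^+ 2 = a%:A).
Local Notation GL2 := {'GL_2(p)}.
Local Notation om := (omega2 alpha).
Implicit Types (g t : GL2).

Let p_gt1 : (1 < p)%N := prime_gt1 p_pr.

Definition det2 g : 'F_p :=
  GL_entry g 0 0 * GL_entry g 1 1 - GL_entry g 0 1 * GL_entry g 1 0.

Lemma omega2_frob t : t \in torus a -> exists u v,
  [/\ (GLval t : 'M_2) = torus_mx a u v, om t = u%:A + v%:A * alpha &
      om t ^+ p = u%:A - v%:A * alpha].
Proof.
move=> /torusP[u [v tuv]]; exists u, v; split=> //; first exact: (omega2E alpha tuv).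
by rewrite (omega2E alpha tuv) (omega_frob p_pr alphaN alpha2).
Qed.

Lemma omega2_det t : t \in torus a -> (det2 t)%:A = om t ^+ p.+1.
Proof.
move=> /omega2_frob[u [v [tuv omE omp]]]; rewrite exprSr omp omE.
rewrite /det2 /GL_entry tuv !mxE /= -!in_algE rmorphB !rmorphM /= -alpha2.
by ring.
Qed.

Lemma omega2_order t : t \in torus a -> om t ^+ (p.-1 * p.+1) = 1.
Proof.
move=> Tt; have [u [v [tuv omE omp]]] := omega2_frob Tt.
apply: (mulfI (omega2_neq0 alpha2 Tt)); rewrite mulr1 -exprS.
have -> : (p.-1 * p.+1).+1 = (p * p)%N by lia.
rewrite exprM omp.
have -> : u%:A - v%:A * alpha = u%:A + (- v)%:A * alpha by rewrite scaleNr mulNr.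
by rewrite (omega_frob p_pr alphaN alpha2) omE scaleNr mulNr opprK.
Qed.

Hypothesis dimK : \dim {:K} = 2%N.

Lemma card_torus_ge : (p.-1 * p.+1 <= #|torus a|)%N.
Proof.
pose f g := (GL_entry g 0 0, GL_entry g 1 0).
pose X := [set uv : 'F_p * 'F_p | uv != 0].
have cX : #|X| = (p.-1 * p.+1)%N.
  have -> : X = [set~ (0, 0)] by apply/setP => uv; rewrite !inE.
  by rewrite cardsC1 card_prod card_Fp //; lia.
rewrite -cX; apply: leq_trans (leq_imset_card f _); apply: subset_leq_card.
apply/subsetP => -[u v]; rewrite inE => uv0.
have x0 : u%:A + v%:A * alpha != 0.
  apply: contra uv0 => /eqP e.
  have [|-> ->] := @alg_alpha_inj p K alpha u v 0 0 alphaN; last by [].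
  by rewrite e !scale0r mul0r addr0.
have [g [[Tg gx] _]] := omega2_bij alpha2 dimK alphaN x0.
apply/imsetP; exists g => //.
by rewrite /f; have [-> ->] := alg_alpha_inj alphaN gx.
Qed.

(** An element of order p in the torus would have omega^p = 1, hence
omega = 1 in characteristic p. *)
Lemma card_torus_neq0 : #|torus a|%:R != 0 :> K.
Proof.
rewrite natK_eq0 //; apply/negP => /(Cauchy p_pr)[t Tt ot].
have omX k : (t ^+ k)%g \in torus a /\ om (t ^+ k)%g = om t ^+ k.
  elim: k => [|k [Tk IHk]]; first by rewrite expg0 group1 omega2_1.
  by rewrite expgS groupM // (omega2M alpha2) // IHk exprS.
have omt : om t = 1.
  have /eqP := congr1 om (expg_order t); rewrite ot (proj2 (omX p)) omega2_1 //.
  have -> : om t ^+ p = (om t - 1) ^+ p + 1.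
    by have := frobK_D p_pr (om t - 1) 1; rewrite subrK expr1n.
  by rewrite -subr_eq0 addrK expf_eq0 subr_eq0 => /andP[_ /eqP].
have [g [_ guniq]] := omega2_bij alpha2 dimK alphaN (oner_neq0 K).
have t1 : t = 1%g.
  by rewrite -(guniq t) // -(guniq 1%g) //; split=> //; exact: omega2_1.
by move: ot p_gt1; rewrite t1 order1 => <-.
Qed.

Lemma index_torus_le : (#|[set: GL2] : torus a|%g <= p * p.-1)%N.
Proof.
have := Lagrange (subsetT (torus a)).
have -> : #|[set: GL2]| = (p * p.-1 ^ 2 * p.+1)%N.
  by have := card_GL_2 'F_p; rewrite card_Fp.
have := card_torus_ge; move: #|torus a| #|_ : _|%g => cT i le_T e.
have p0 : (0 < p.-1 * p.+1)%N by rewrite muln_gt0; lia.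
rewrite -(leq_pmul2l p0) (leq_trans (leq_mul le_T (leqnn i))) // e.
by rewrite expnS expn1; lia.
Qed.

Local Notation V := (sym_rep K).

(** The torus eigencoordinates on V_n, see psi. *)
Definition cf n j (P : dhomog 2 K n) : K^o := (psi alpha P)`_j.
Fact cf_is_linear n j : linear (@cf n j).
Proof. by move=> c P Q; rewrite /cf linearP coefD coefZ. Qed.
HB.instance Definition _ n j := GRing.isLinear.Build K (dhomog 2 K n) K^o _
  (@cf n j) (@cf_is_linear n j).

Lemma cf_torus n j t (P : V n) : t \in torus a ->
  cf j (rep_act (V n) t P) = om t ^+ (n + p.-1 * j) * cf j P.
Proof.
move=> Tt; rewrite /cf /= lfunE /=.
exact: (coef_psi_torus p_pr alphaN alpha2 j Tt (dhomog_is_dhomog P)).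
Qed.

Section Levels.
Variables (n m : nat).
Hypotheses (le_mn : (2 * m < n)%N) (lt_np : (n < p)%N).
Local Notation L := (dickson K : {mpoly K[2]}).
Local Notation theta := (@theta p K).
Local Notation N := (n + m.+1 * p.-1)%N.
Implicit Types (P Q : {mpoly K[2]}).

Lemma dickson_torus t i P : t \in torus a ->
  (L ^+ i * P) \mPo GL_subst K t =
  om t ^+ (p.+1 * i) *: (L ^+ i * (P \mPo GL_subst K t)).
Proof.
move=> Tt; rewrite rmorphM rmorphXn /= dickson_subst // -/(det2 t) omega2_det //.
by rewrite exprZn -scalerAl exprM.
Qed.

Lemma rep_act_symE d t (P : dhomog 2 K d) :
  rep_act (V d) t P = P \mPo GL_subst K t :> {mpoly K[2]}.
Proof. by rewrite /= lfunE. Qed.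

(** The e-th layer of the filtration of V_N by the images of the powers of D,
e = m - i, is a copy of V_(n-2i+p-1) / D V_(n-2i) twisted by det^i. A torus
eigenfunctional on this quotient is extended to V_N: first by linear algebra, with
value zero on the next step of the filtration, then by averaging over the torus.
The extension is consistent because D is injective and strict with respect to
the Dickson invariant. *)
Lemma level_functional i k (lam : 'Hom(V (n - 2 * i + p.-1), K^o)) :
    (i <= m)%N ->
    (forall (P : dhomog 2 K (n - 2 * i + p.-1)) Q, Q \is (n - 2 * i).-homog ->
       P = theta Q :> {mpoly K[2]} -> lam P = 0) ->
    (forall t (P : dhomog 2 K _), t \in torus a ->
       lam (rep_act (V _) t P) = om t ^+ k * lam P) ->
  exists lam' : 'Hom(V N, K^o),
    (forall t (P : dhomog 2 K N), t \in torus a ->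
       lam' (rep_act (V N) t P) = om t ^+ (k + p.+1 * i) * lam' P) /\
    (forall (P : dhomog 2 K (n - 2 * i + p.-1)) Q (R : dhomog 2 K N),
          Q \is (n + i * p.-1).-homog ->
          R = iter (m - i) theta (L ^+ i * P + theta Q) :> {mpoly K[2]} ->
          lam' R = lam P).
Proof.
move=> le_im; set ni := (n - 2 * i)%N in lam * => lam0 lamT.
have eki : (n + i * p.-1 = ni + i * p.+1)%N by rewrite /ni; nia.
have eki1 : (n + i.+1 * p.-1 = ni + i * p.+1 + p.-1)%N by rewrite -eki; nia.
have Lh P : P \is (ni + p.-1).-homog -> L ^+ i * P \is (n + i.+1 * p.-1).-homog.
  move=> Ph; have := dhomogM (dickson_homog K i) Ph.
  by have -> : (i * p.+1 + (ni + p.-1) = n + i.+1 * p.-1)%N by lia.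
have fh (P : dhomog 2 K (ni + p.-1)) : iter (m - i) theta (L ^+ i * P) \is N.-homog.
  have := iter_theta_homog p_pr (m - i) (Lh _ (dhomog_is_dhomog P)).
  by have -> : (n + i.+1 * p.-1 + (m - i) * p.-1 = N)%N by nia.
have gh (Q : dhomog 2 K (n + i * p.-1)) : iter (m - i).+1 theta Q \is N.-homog.
  have := iter_theta_homog p_pr (m - i).+1 (dhomog_is_dhomog Q).
  by have -> : (n + i * p.-1 + (m - i).+1 * p.-1 = N)%N by nia.
pose f (P : dhomog 2 K (ni + p.-1)) : dhomog 2 K N := DHomog (fh P).
pose g (Q : dhomog 2 K (n + i * p.-1)) : dhomog 2 K N := DHomog (gh Q).
have f_lin : linear f.
  move=> c P Q; apply: val_inj; rewrite /= mulrDr -scalerAr.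
  by rewrite iter_theta_is_linear.
have g_lin : linear g.
  by move=> c P Q; apply: val_inj; exact: (iter_theta_is_linear (m - i).+1).
pose fL : {linear dhomog 2 K (ni + p.-1) -> dhomog 2 K N} :=
  HB.pack f (GRing.isLinear.Build K _ _ _ f f_lin).
pose gL : {linear dhomog 2 K (n + i * p.-1) -> dhomog 2 K N} :=
  HB.pack g (GRing.isLinear.Build K _ _ _ g g_lin).
have [|lam1 [lam1f lam1g]] := @functional_ext _ _ _ _ (linfun fL) (linfun gL) lam.
  move=> P Q; rewrite !lfunE /= => /(congr1 val) /= e.
  have e0 : L ^+ i * P - theta Q = 0.
    apply: (iter_theta_inj p_pr (s := i.+1) (e := (m - i)%N) le_mn lt_np); first by lia.
      apply: rpredB; first exact/Lh/dhomog_is_dhomog.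
      have := theta_homog p_pr (dhomog_is_dhomog Q).
      by have -> : (n + i * p.-1 + p.-1 = n + i.+1 * p.-1)%N by nia.
    have := iter_theta_is_linear (p := p) (K := K) (m - i) (-1) (theta Q) (L ^+ i * P).
    by rewrite !scaleN1r addrC e -iterS iterSr subrr [- theta Q + _]addrC.
  have Qh : (Q : {mpoly K[2]}) \is (ni + i * p.+1).-homog.
    by rewrite -eki dhomog_is_dhomog.
  have [|||Q' Q'h [eP _]] := theta_strict p_pr _ _ (dhomog_is_dhomog P) Qh _.
  - by rewrite /ni; lia.
  - by rewrite /ni; lia.
  - by apply/eqP; rewrite -subr_eq0 e0.
  exact: lam0 Q'h eP.
pose T := torus a.
have [||| lam' [lam'T lam'E]] := @eigen_average K _ T
  (res_rep (subsetT T) (V N)) (fun t => om t ^+ (k + p.+1 * i)) lam1.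
- exact: card_torus_neq0.
- by move=> s t Ts Tt; rewrite (omega2M alpha2) // exprMn.
- by move=> t Tt; rewrite expf_neq0 // (omega2_neq0 alpha2).
have fLE (P : dhomog 2 K (ni + p.-1)) : linfun fL P = f P by rewrite lfunE.
have gLE (Q : dhomog 2 K (n + i * p.-1)) : linfun gL Q = g Q by rewrite lfunE.
have lam'f (P : dhomog 2 K (ni + p.-1)) : lam' (linfun fL P) = lam P.
  apply: lam'E => t Tt.
  have -> : rep_act (V N) t (linfun fL P) =
      linfun fL (om t ^+ (p.+1 * i) *: rep_act (V _) t P : dhomog 2 K _).
    apply: val_inj; rewrite [LHS]rep_act_symE !fLE.
    rewrite [RHS]/= -scalerAr iter_thetaZ rep_act_symE.
    by rewrite iter_theta_subst // dickson_torus // iter_thetaZ.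
  rewrite lam1f linearZ /= lamT // exprD.
  transitivity (om t ^+ (p.+1 * i) * (om t ^+ k * lam P)); first by [].
  by rewrite mulrCA mulrA.
have lam'g (Q : dhomog 2 K (n + i * p.-1)) : lam' (linfun gL Q) = 0.
  apply: lam'E => t Tt; rewrite mulr0.
  have -> : rep_act (V N) t (linfun gL Q) =
      linfun gL (rep_act (V _) t Q : dhomog 2 K _).
    apply: val_inj; rewrite [LHS]rep_act_symE !gLE.
    by rewrite iter_theta_subst // [RHS]/= rep_act_symE.
  exact: lam1g.
exists lam'; split=> [t P Tt|P Q R Qh eR]; first exact: lam'T.
have -> : R = linfun fL P + linfun gL (DHomog Qh).
  apply: val_inj; rewrite [LHS]eR raddfD /= fLE gLE /=.
  by rewrite iterD_theta -iterS iterSr.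
by rewrite linearD /= lam'f lam'g addr0.
Qed.

End Levels.
End Torus.

(** * The Borel subgroup *)

Section Borel.
Variable p : nat.
Hypothesis p_pr : prime p.
Local Notation GL2 := {'GL_2(p)}.

(** The matrix (1 b; 0 d). *)
Definition bor (d b : 'F_p) : GL2 := odflt 1%g [pick g : GL2 |
  [&& GL_entry g 0 0 == 1, GL_entry g 0 1 == b, GL_entry g 1 0 == 0 &
      GL_entry g 1 1 == d]].

Lemma borE d b : d != 0 ->
  [/\ GL_entry (bor d b) 0 0 = 1, GL_entry (bor d b) 0 1 = b,
      GL_entry (bor d b) 1 0 = 0 & GL_entry (bor d b) 1 1 = d].
Proof.
move=> d0; rewrite /bor; case: pickP => [g /and4P[/eqP ? /eqP ? /eqP ? /eqP ?] //|noG].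
pose M : 'M['F_p]_2 := \matrix_(i, j)
  (if i == 0 then (if j == 0 then 1 else b) else (if j == 0 then 0 else d)).
have detM : \det M = d.
  rewrite (expand_det_row _ 0) big_ord_recl big_ord1 /cofactor !det_mx11 !mxE /=.
  by rewrite /= expr0 expr1; ring.
have unitM : (M : 'M['F_p]_(2.-1.+1)) \is a GRing.unit.
  by rewrite -[_ \is a _]/(M \in unitmx) unitmxE unitfE detM.
by have := noG (FinRing.Unit unitM); rewrite /GL_entry /= !mxE /= !eqxx.
Qed.

Lemma GL_entryM (g h : GL2) i j : GL_entry (g * h)%g i j =
  GL_entry g i 0 * GL_entry h 0 j + GL_entry g i 1 * GL_entry h 1 j.
Proof.
rewrite /GL_entry /= mxE big_ord_recl big_ord1; congr (_ + _ * _).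
  by congr (GLval g _ _); apply: val_inj.
by congr (GLval h _ _); apply: val_inj.
Qed.

Lemma GL_entry_inj (g h : GL2) :
    GL_entry g 0 0 = GL_entry h 0 0 -> GL_entry g 0 1 = GL_entry h 0 1 ->
    GL_entry g 1 0 = GL_entry h 1 0 -> GL_entry g 1 1 = GL_entry h 1 1 -> g = h.
Proof.
move=> e00 e01 e10 e11; apply/val_inj/matrixP => i j.
have ord2 (k : 'I_2) : k = 0 \/ k = 1.
  by case: k => [[|[|//]] lt_k]; [left | right]; apply: val_inj.
by case: (ord2 i) => ->; case: (ord2 j) => ->.
Qed.

Lemma borM d b c : d != 0 -> (bor d b * bor 1%R c)%g = bor d (b + c).
Proof.
move=> d0; have [g00 g01 g10 g11] := borE b d0.
have [h00 h01 h10 h11] := borE c (oner_neq0 'F_p).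
have [k00 k01 k10 k11] := borE (b + c) d0.
apply: GL_entry_inj; rewrite GL_entryM.
- by rewrite g00 g01 h00 h10 k00 mulr1 mulr0 addr0.
- by rewrite g00 g01 h01 h11 k01 mulr1 mul1r addrC.
- by rewrite g10 g11 h00 h10 k10 mul0r mulr0 addr0.
- by rewrite g10 g11 h01 h11 k11 mul0r mulr1 add0r.
Qed.

Lemma bor10 : bor 1 0 = 1%g.
Proof.
have [h00 h01 h10 h11] := borE 0 (oner_neq0 'F_p).
by apply: GL_entry_inj; rewrite ?h00 ?h01 ?h10 ?h11 /GL_entry /= mxE.
Qed.
End Borel.

(** * Functionals on the cokernel of D *)

Section Level.
Variables (p : nat) (K : fieldExtType 'F_p).
Hypotheses (p_pr : prime p) (p_odd : odd p).
Variables (alpha : K) (a : 'F_p).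
Hypotheses (dimK : \dim {:K} = 2%N).
Hypotheses (alphaN : alpha \notin 1%VS) (alpha2 : alpha ^+ 2 = a%:A).
Local Notation GL2 := {'GL_2(p)}.
Local Notation om := (omega2 alpha).
Local Notation V := (sym_rep K).
Local Notation L := (dickson K : {mpoly K[2]}).
Local Notation theta := (@theta p K).

Variables (n m : nat).
Hypotheses (le_mn : (2 * m < n)%N) (lt_np : (n < p)%N).
Local Notation N := (n + m.+1 * p.-1)%N.
Local Notation A := (coker_Dpow K p_pr n m.+1).
Local Notation U := (limg (Dpow K p_pr n m.+1)).

Lemma coker_zero (P : dhomog 2 K N) Q : Q \is n.-homog ->
  P = iter m.+1 theta Q :> {mpoly K[2]} -> vquot_pi U P = 0.
Proof.
move=> Qh eP; rewrite -[RHS](linear0 (vquot_pi U)); apply/vquot_pi_eq.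
rewrite subr0; apply/memv_imgP; exists (DHomog Qh); rewrite ?memvf //.
by apply: val_inj; rewrite lfunE.
Qed.

Lemma coker_memP (P : dhomog 2 K N) : P \in U ->
  exists2 Q, Q \is n.-homog & P = iter m.+1 theta Q :> {mpoly K[2]}.
Proof.
case/memv_imgP => Q _ ->; exists Q; first exact: dhomog_is_dhomog.
by rewrite lfunE.
Qed.

(** The two functionals that make up the pairing of parameter n - 2i,
transported to the layer m - i. *)
Lemma level_pair i : (i <= m)%N -> exists l1 l2 : 'Hom(V N, K^o),
  [/\ forall t (P : dhomog 2 K N), t \in torus a ->
        l1 (rep_act (V N) t P) =
          om t ^+ (n - 2 * i + p.-1 + p.-1 * p.-1 + p.+1 * i) * l1 P /\
        l2 (rep_act (V N) t P) = om t ^+ (n - 2 * i + p.-1 + p.+1 * i) * l2 P,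
      forall (P : dhomog 2 K (n - 2 * i + p.-1)) Q (R : dhomog 2 K N),
        Q \is (n + i * p.-1).-homog ->
        R = iter (m - i) theta (L ^+ i * P + theta Q) :> {mpoly K[2]} ->
        l1 R = (psi alpha P)`_p.-1 /\
        l2 R = (psi alpha P)`_p.+1 - ((n - 2 * i)%:R - 1) * (psi alpha P)`_0 &
      forall R : dhomog 2 K N, R \in U -> l1 R = 0 /\ l2 R = 0].
Proof.
move=> le_im; set ni := (n - 2 * i)%N.
pose lam1 : 'Hom(V (ni + p.-1), K^o) := linfun (cf alpha p.-1).
pose lam2 : 'Hom(V (ni + p.-1), K^o) :=
  linfun (cf alpha p.+1) - (ni%:R - 1) *: linfun (cf alpha 0).
have lam1E (P : dhomog 2 K (ni + p.-1)) : lam1 P = (psi alpha P)`_p.-1.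
  by rewrite lfunE.
have lam2E (P : dhomog 2 K (ni + p.-1)) :
    lam2 P = (psi alpha P)`_p.+1 - (ni%:R - 1) * (psi alpha P)`_0.
  by rewrite add_lfunE opp_lfunE scale_lfunE !lfunE.
have lt_nip : (ni < p)%N by rewrite /ni; lia.
have [|| l1 [l1T l1E]] := level_functional p_pr alphaN alpha2 dimK le_mn lt_np
  (lam := lam1) (k := ni + p.-1 + p.-1 * p.-1) le_im.
- by move=> P Q Qh eP; rewrite lam1E eP;
  exact: (psi_theta_pred p_pr p_odd alphaN alpha2 Qh).
- move=> t P Tt; rewrite [lam1 P]lfunE [lam1 _]lfunE.
  exact: (cf_torus p_pr alphaN alpha2 p.-1 P Tt).
have [|| l2 [l2T l2E]] := level_functional p_pr alphaN alpha2 dimK le_mn lt_np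
  (lam := lam2) (k := ni + p.-1) le_im.
- move=> P Q Qh eP; rewrite lam2E eP.
  by rewrite (psi_theta_succ p_pr p_odd alphaN alpha2 lt_nip Qh) subrr.
- move=> t P Tt; rewrite lam2E [LHS]/=.
  have c0 := cf_torus p_pr alphaN alpha2 0 P Tt.
  have cp := cf_torus p_pr alphaN alpha2 p.+1 P Tt.
  rewrite exprD (omega2_order p_pr alphaN alpha2 Tt) mulr1 in cp.
  rewrite muln0 addn0 in c0.
  rewrite -[X in X - _ = _]/(cf alpha p.+1 (rep_act (V _) t P)).
  rewrite -[X in _ - _ * X = _]/(cf alpha 0 (rep_act (V _) t P)) cp c0 lam2E.
  by rewrite /cf; ring.
exists l1, l2; split=> [t P Tt|P Q R Qh eR|R UR].
- by rewrite l1T // l2T.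
- by rewrite (l1E _ _ _ Qh eR) (l2E _ _ _ Qh eR) lam1E lam2E.
have [Q Qh eR] := coker_memP UR.
have Q'h := iter_theta_homog p_pr i Qh.
have eR' : R = iter (m - i) theta (L ^+ i * (0 : dhomog 2 K (ni + p.-1)) +
    theta (iter i theta Q)) :> {mpoly K[2]}.
  rewrite raddf0 mulr0 add0r -iterS -iterD eR.
  by have -> : (m - i + i.+1 = m.+1)%N by lia.
by rewrite (l1E _ _ _ Q'h eR') (l2E _ _ _ Q'h eR') !linear0.
Qed.

End Level.

(** * Eigenfunctionals on the tensor product *)

Section Form.
Variables (p : nat) (K : fieldExtType 'F_p).
Hypotheses (p_pr : prime p) (p_odd : odd p).
Variables (alpha : K) (a : 'F_p).
Hypotheses (dimK : \dim {:K} = 2%N).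
Hypotheses (alphaN : alpha \notin 1%VS) (alpha2 : alpha ^+ 2 = a%:A).
Local Notation GL2 := {'GL_2(p)}.
Local Notation om := (omega2 alpha).
Local Notation V := (sym_rep K).
Local Notation L := (dickson K : {mpoly K[2]}).
Local Notation theta := (@theta p K).

(** x is the sum over b of the translates by (1 b; 0 1) of y tensor the spike,
a tensor being tested against the functionals on X. *)
Definition spread (X : rep K [set: GL2]) (x : tensor X (V p.-1)) (y : X) :=
  forall lam : 'Hom(X, K^o), x lam = \sum_(b : 'F_p)
    (lam (rep_act X (bor 1 b) y) : K) *: rep_act (V p.-1) (bor 1 b) (spike_form K).

Variables (n m : nat).
Hypotheses (le_mn : (2 * m < n)%N) (lt_np : (n < p)%N).
Local Notation N := (n + m.+1 * p.-1)%N.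
Local Notation A := (coker_Dpow K p_pr n m.+1).
Local Notation U := (limg (Dpow K p_pr n m.+1)).
Local Notation M := (tens_rep A (V p.-1)).

Lemma cokerE g (P : dhomog 2 K N) :
  rep_act A g (vquot_pi U P) = vquot_pi U (rep_act (V N) g P).
Proof. exact: (quot_actE (@limg_Dpow_subrep p K p_pr n m.+1) P (in_setT g)). Qed.

(** If P lies in the step m - i of the filtration by the images of the
powers of D and the form vanishes on all translates of the spread of P, then P lies
in the next step: on this layer the form is the pairing. *)
Lemma level_form i : (i <= m)%N -> exists B : 'Hom(M, K^o),
  (forall t x, t \in torus a -> B (rep_act M t x) = om t ^+ (n + i * p.-1) * B x) /\
  (forall x (P : dhomog 2 K N) Q, spread (x : tensor A (V p.-1)) (vquot_pi U P) ->
     Q \is (n + i.+1 * p.-1).-homog ->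
     P = iter (m - i) theta Q :> {mpoly K[2]} ->
     (forall d, d != 0 -> B (rep_act M (bor d 0) x) = 0) ->
   exists2 Q', Q' \is (n + i * p.-1).-homog & Q = theta Q').
Proof.
move=> le_im.
have [l1 [l2 [lT lE lU]]] :=
  level_pair p_pr p_odd dimK alphaN alpha2 le_mn lt_np le_im.
have [q1 q1E] := vquot_functional (fun R UR => proj1 (lU R UR)).
have [q2 q2E] := vquot_functional (fun R UR => proj2 (lU R UR)).
set ni := (n - 2 * i)%N in lT lE.
have ni_gt0 : (0 < ni)%N by rewrite /ni; lia.
have lt_ni : (ni + i < p)%N by rewrite /ni; lia.
have lt_nip : (ni < p)%N by apply: leq_ltn_trans lt_ni; exact: leq_addr.
have eki : (n + i * p.-1 = ni + i * p.+1)%N by rewrite /ni; nia.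
pose f1 : 'Hom(V p.-1, K^o) := linfun (cf alpha 0).
pose f2 : 'Hom(V p.-1, K^o) := linfun (cf alpha p.-1).
have f1E (R : dhomog 2 K p.-1) : f1 R = cf alpha 0 R by rewrite lfunE.
have f2E (R : dhomog 2 K p.-1) : f2 R = cf alpha p.-1 R by rewrite lfunE.
have [B [BT BE]] := @tens_form _ _ _ A (V p.-1) q1 q2 f1 f2 alpha.
have q1g g P : q1 (rep_act A g (vquot_pi U P)) = l1 (rep_act (V N) g P).
  by rewrite cokerE q1E.
have q2g g P : q2 (rep_act A g (vquot_pi U P)) = l2 (rep_act (V N) g P).
  by rewrite cokerE q2E.
exists B; split=> [t x Tt|x P Q spx Qh eP B0].
  have -> : om t ^+ (n + i * p.-1) =
      om t ^+ (ni + p.-1 + p.-1 * p.-1 + p.+1 * i) * om t ^+ (p.-1 + p.-1 * 0).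
    have tpp := omega2_order p_pr alphaN alpha2 Tt.
    (* 2i is traded for i(p+1): the exponents differ by p^2 - 1 *)
    rewrite -exprD -[LHS]mulr1 -tpp -exprD; congr (_ ^+ _).
    by rewrite /ni; nia.
  apply: (BT t _ (om t ^+ (ni + p.-1 + p.+1 * i)) _
     (om t ^+ (p.-1 + p.-1 * p.-1))).
  - move=> y; have [R <-] := vquot_pi_surj y.
    by rewrite q1g q1E (proj1 (lT _ _ Tt)).
  - move=> y; have [R <-] := vquot_pi_surj y.
    by rewrite q2g q2E (proj2 (lT _ _ Tt)).
  - by move=> R; rewrite !f1E (cf_torus p_pr alphaN alpha2 0 R Tt).
  - by move=> R; rewrite !f2E (cf_torus p_pr alphaN alpha2 p.-1 R Tt).
  - by rewrite -!exprD; congr (_ ^+ _); lia.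
have eki1 : (n + i.+1 * p.-1 = ni + i * p.+1 + p.-1)%N.
  by rewrite -eki mulSn addnCA addnC.
rewrite eki1 in Qh; have [P' [Q' [P'h Q'h eQ]]] := theta_decomp p_pr ni_gt0 lt_ni Qh.
rewrite -eki in Q'h.
have [|| Q'' Q''h eP'] := sum_pairing_eq0 p_pr p_odd alphaN alpha2 ni_gt0 lt_nip P'h _ _.
- move=> R d b d0 Rh; have [g00 g01 g10 g11] := borE b d0.
  exact: (pairing_theta p_pr p_odd alphaN alpha2 lt_nip g00 g01 g10 g11 Rh).
- move=> d d0; have dK0 : (d%:A : K) ^+ i != 0.
    by rewrite expf_neq0 // scaler_eq0 negb_or d0 oner_neq0.
  apply: (mulfI dK0); rewrite mulr0 mulr_sumr -[RHS](B0 d d0) (BE _ _ _ _ _ spx).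
  apply: eq_bigr => b _.
  have [g00 g01 g10 g11] := borE b d0.
  rewrite !rep_actMv borM // add0r.
  set g := bor d b in g00 g01 g10 g11 *.
  pose P1 : dhomog 2 K (ni + p.-1) := d%:A ^+ i *: (rep_act (V _) g (DHomog P'h)).
  have eR : rep_act (V N) g P = iter (m - i) theta
      (L ^+ i * P1 + theta (Q' \mPo GL_subst K g)) :> {mpoly K[2]}.
    rewrite rep_act_symE eP iter_theta_subst // eQ rmorphD /= theta_subst //.
    rewrite rmorphM rmorphXn /= dickson_subst // g00 g11 g01 g10 mul1r mulr0 subr0.
    by rewrite exprZn -scalerAl scalerAr rep_act_symE.
  have [e1 e2] := lE _ _ _ (GL_subst_homog g Q'h) eR.
  rewrite q1g q2g e1 e2 f1E f2E /cf rep_act_symE /P1 /= linearZ /=.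
  rewrite rep_act_symE /= !(evd_psi alpha _ g00 g01 g10 g11).
  by rewrite /pairing !coefZ; ring.
exists (L ^+ i * Q'' + Q').
  rewrite rpredD // eki addnC; apply: dhomogM => //; exact: dickson_homog.
by rewrite raddfD /= theta_dickson // -eP'.
Qed.
End Form.

(** * Invariants of the unipotent subgroup *)

Section Spread.
Variables (p : nat) (K : fieldExtType 'F_p).
Hypothesis p_pr : prime p.
Local Notation GL2 := {'GL_2(p)}.
Local Notation V := (sym_rep K).
Local Notation eta := (ev 1 'X : {mpoly K[2]} -> {poly K}).
Let p_gt1 : (1 < p)%N := prime_gt1 p_pr.

Lemma eta_bor b (R : {mpoly K[2]}) :
  eta (R \mPo GL_subst K (bor 1 b)) = eta R \Po ('X + (b%:A)%:P).
Proof.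
have [g00 g01 g10 g11] := borE b (oner_neq0 'F_p).
rewrite ev_subst g00 g01 g10 g11 !scale1r !scale0r addr0 -ev_comp.
by rewrite comp_polyX -polyC1 comp_polyC alg_polyC addrC.
Qed.

(** Lagrange interpolation at the points (1, -b): both sides have degree less
than p in the affine chart. *)
Lemma spike_interp (R : dhomog 2 K p.-1) :
  R = \sum_(b : 'F_p) (eta R).[- b%:A] *: rep_act (V p.-1) (bor 1 b) (spike_form K).
Proof.
set S := \sum_b _; pose f := eta R - eta (S : dhomog 2 K p.-1).
have f0 : f = 0.
  apply/eqP; apply: contraT => f_neq0.
  have := max_poly_roots f_neq0 (rs := [seq (c%:A : K) | c <- enum 'F_p]).
  rewrite map_inj_uniq ?enum_uniq; last exact: (fmorph_inj (in_alg K)).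
  rewrite size_map -cardE card_Fp // ltnNge.
  have -> : (size f <= p)%N.
    rewrite (leq_trans (size_polyD _ _)) // geq_max size_polyN.
    have p_gt0 := ltnW p_gt1; rewrite -[X in (_ <= X)%N && _](prednK p_gt0).
    rewrite -[X in _ && (_ <= X)%N](prednK p_gt0).
    by rewrite !(@size_eta p) ?dhomog_is_dhomog.
  suff -> : all (root f) [seq (c%:A : K) | c <- enum 'F_p] by move=> /(_ isT isT).
  apply/allP => _ /mapP[c _ ->]; apply/rootP.
  have key b : (eta (rep_act (V p.-1) (bor 1 b) (spike_form K) : dhomog 2 K p.-1)).[c%:A]
      = (b == - c)%:R.
    rewrite rep_act_symE eta_bor horner_comp rmorphB !rmorphXn /= ev0 ev1 expr1n.
    rewrite !hornerE -scalerDl -in_algE -rmorphXn /=; case: eqP => [->|/eqP bc].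
      by rewrite subrr expr0n -subn1 subn_eq0 leqNgt p_gt1 scale0r subr0.
    have cb : c + b != 0 by rewrite addrC addr_eq0.
    rewrite (_ : (c + b) ^+ p.-1 = 1) ?scale1r ?subrr //.
    apply: (mulfI cb); rewrite -exprS prednK ?(ltnW p_gt1) // mulr1.
    by have := expf_card (c + b); rewrite card_Fp.
  have -> : f.[c%:A] = (eta R).[c%:A] - \sum_(b : 'F_p) (eta R).[- b%:A] *
     (eta (rep_act (V p.-1) (bor 1 b) (spike_form K) : dhomog 2 K p.-1)).[c%:A].
    rewrite /f hornerD hornerN; congr (_ - _); rewrite /S raddf_sum /= raddf_sum /=.
    by rewrite horner_sum; apply: eq_bigr => b _; rewrite linearZ /= ?evZ hornerZ.
  rewrite (bigD1 (- c)) //= key eqxx mulr1 scaleNr opprK.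
  rewrite [X in _ - (_ + X)]big1 ?addr0 ?subrr // => b bc.
  by rewrite key (negPf bc) mulr0.
apply: val_inj; apply: (@eta_inj2 p K p.-1); try exact: dhomog_is_dhomog.
by apply/eqP; rewrite -subr_eq0; apply/eqP.
Qed.

(** As a representation of the unipotent subgroup V_(p-1) is regular, so an
invariant tensor is determined by one component. It is the contraction of x with
the value at (1, 0); invariance gives the contractions with the values at (1, -b). *)
Lemma fixed_spread (X : rep K [set: GL2]) (x : tens_rep X (V p.-1)) :
    (forall b, rep_act (tens_rep X (V p.-1)) (bor 1 b) x = x) ->
  exists y : X, spread (x : tensor X (V p.-1)) y.
Proof.
move=> xfix; pose x' : tensor X (V p.-1) := x.
pose ev0R (R : dhomog 2 K p.-1) : K := (eta R).[0].
pose e i : X := (vbasis {:X})`_i.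
pose e' i : 'Hom(X, K^o) := linfun (coord (vbasis {:X}) i : X -> K^o).
pose y : X := \sum_(i < \dim {:X}) ev0R (x' (e' i)) *: e i.
have yE lam : ev0R (x' lam) = lam y.
  have xE := congr1 (fun z : tensor X (V p.-1) => z lam) (tensor_span x').
  rewrite /= sum_lfunE in xE; rewrite xE /ev0R raddf_sum /= raddf_sum /= horner_sum.
  rewrite linear_sum; apply: eq_bigr => i _.
  by rewrite tensE linearZ /= ?evZ hornerZ -/x' [in RHS]linearZ mulrC.
exists y => lam; rewrite {1}[x lam](spike_interp (x' lam)).
apply: eq_bigr => b _; congr (_ *: _).
have -> : x' lam = rep_act (V p.-1) (bor 1 b) (x' (lam \o rep_act X (bor 1 b))%VF).
  by rewrite -tens_act_apply xfix.
by rewrite rep_act_symE eta_bor horner_comp !hornerE addNr -comp_lfunE -yE.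
Qed.

End Spread.

(** * The isomorphism *)

Section Final.
Variables (p : nat) (K : fieldExtType 'F_p).
Hypotheses (p_pr : prime p) (p_odd : odd p).
Variables (alpha : K) (a : 'F_p).
Hypotheses (dimK : \dim {:K} = 2%N).
Hypotheses (alphaN : alpha \notin 1%VS) (alpha2 : alpha ^+ 2 = a%:A).
Local Notation GL2 := {'GL_2(p)}.
Local Notation om := (omega2 alpha).
Local Notation V := (sym_rep K).
Local Notation T := (torus a).
Local Notation theta := (@theta p K).
Let p_gt1 : (1 < p)%N := prime_gt1 p_pr.

Lemma eigenform_homog m i : (i <= m)%N ->
  ((alpha *: 'X_0 + 'X_1) ^+ (m - i) * ('X_1 - alpha *: 'X_0) ^+ i : {mpoly K[2]})
    \is m.-homog.
Proof.
move=> le_im; have Xh (j : 'I_2) : ('X_j : {mpoly K[2]}) \is 1.-homog.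
  by rewrite dhomogX; apply/eqP; exact: mdeg1.
have powh (l : {mpoly K[2]}) e : l \is 1.-homog -> l ^+ e \is e.-homog.
  by move=> lh; have := dhomogMn e lh; rewrite mul1n.
have h1 : (alpha *: 'X_0 + 'X_1 : {mpoly K[2]}) \is 1.-homog.
  by apply: rpredD => //; apply: rpredZ.
have h2 : ('X_1 - alpha *: 'X_0 : {mpoly K[2]}) \is 1.-homog.
  by apply: rpredB => //; apply: rpredZ.
by have := dhomogM (powh _ (m - i)%N h1) (powh _ i h2); rewrite subnK.
Qed.

(** The basis of V_m dual to its torus eigencoordinates, up to nonzero
scalars. *)
Definition eigenform m (i : 'I_m.+1) : dhomog 2 K m :=
  DHomog (eigenform_homog (leq_ord i)).

Lemma eigenform_torus m (i : 'I_m.+1) t : t \in T ->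
  rep_act (V m) t (eigenform i) = om t ^+ (m + p.-1 * i) *: eigenform i.
Proof.
move=> Tt; apply: val_inj; rewrite [LHS]rep_act_symE /=.
have [u [v [tuv omE omp]]] := omega2_frob p_pr alphaN alpha2 Tt.
have X0E : 'X_0 \mPo GL_subst K t = u%:A *: 'X_0 + v%:A *: 'X_1.
  by rewrite comp_mpolyXU /= /GL_entry tuv !mxE.
have X1E : 'X_1 \mPo GL_subst K t = (v * a)%:A *: 'X_0 + u%:A *: 'X_1.
  by rewrite comp_mpolyXU /= /GL_entry tuv !mxE.
have va : (v * a)%:A = v%:A * alpha * alpha.
  by rewrite -mulrA -expr2 alpha2 -!in_algE rmorphM.
rewrite rmorphM !rmorphXn /= rmorphD rmorphB /= !comp_mpolyZ X0E X1E va.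
have e1 (x y : K) (X Y : {mpoly K[2]}) :
    alpha *: (x *: X + y *: Y) + ((y * alpha * alpha) *: X + x *: Y) =
    (x + y * alpha) *: (alpha *: X + Y).
  by rewrite -!mul_mpolyC !(mpolyCD, mpolyCM); ring.
have e2 (x y : K) (X Y : {mpoly K[2]}) :
    (y * alpha * alpha) *: X + x *: Y - alpha *: (x *: X + y *: Y) =
    (x - y * alpha) *: (Y - alpha *: X).
  by rewrite -!mul_mpolyC !(mpolyCB, mpolyCM); ring.
rewrite e1 e2 -omE -omp.
rewrite !exprZn -scalerAl -scalerAr scalerA -exprM -exprD; congr (_ ^+ _ *: _).
have := leq_ord i; have := p_gt1; nia.
Qed.

Lemma cf_eigenform m (i j : 'I_m.+1) :
  cf alpha j (eigenform i) =
  ((2%:R * alpha) ^+ (m - i) * (- (2%:R * alpha)) ^+ i) *+ (j == i).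
Proof.
rewrite /cf /psi rmorphM !rmorphXn /= rmorphD rmorphB /= !linearZ /= ev0 ev1.
have -> : alpha *: (1 + 'X) + alpha *: (1 - 'X) = (2%:R * alpha)%:P.
  by rewrite -scalerDr addrACA subrr addr0 -mul_polyC -polyC1 -polyCD -polyCM mulrC.
have -> : alpha *: (1 - 'X) + alpha *: - (1 + 'X) = (- (2%:R * alpha))%:P * 'X.
  by rewrite -!mul_polyC polyCN polyCM polyC_natr; ring.
rewrite exprMn -!polyC_exp mulrA -polyCM mul_polyC coefZ coefXn mulr_natr.
by rewrite -val_eqE.
Qed.

Lemma two_alpha_neq0 : 2%:R * alpha != 0.
Proof.
rewrite mulf_neq0 ?(alpha_neq0 alphaN) // natK_eq0 // gtnNdvd //.
by move: p_odd p_gt1; case: (p) => [|[|[|]]].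
Qed.

Lemma dim_V d : dim (V d) = d.+1.
Proof. by rewrite -[LHS]/'C(d + 1, d) addn1 binSn. Qed.

Section Numeric.
Variables (n m : nat).
Hypotheses (le_mn : (2 * m < n)%N) (lt_np : (n < p)%N).
Local Notation N := (n + m.+1 * p.-1)%N.
Local Notation A := (coker_Dpow K p_pr n m.+1).
Local Notation U := (limg (Dpow K p_pr n m.+1)).
Local Notation M := (tens_rep A (V p.-1)).
Variable k : int.
Hypothesis k_eq : k = (n - m)%N.
Local Notation W := (tens_rep (res_rep (subsetT T) (V m)) (omega2_rep alpha2 k)).

Lemma dim_coker : dim A = (m.+1 * p.-1)%N.
Proof.
rewrite -[LHS]/(\dim U^C) dimv_compl dimvf limg_dim_eq.
  by rewrite dimvf !dim_V subSS addKn.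
apply/eqP; rewrite -subv0; apply/subvP => P; rewrite memv_cap memv_ker memv0.
case/andP=> _; rewrite lfunE /= => /eqP/(congr1 val) /= e.
apply/eqP/val_inj => /=.
apply: (iter_theta_inj p_pr (s := 0) (e := m.+1) le_mn lt_np _ _ e).
  by rewrite add0n.
by rewrite addn0 dhomog_is_dhomog.
Qed.

Lemma dim_ind_le : (dim (ind_rep W) <= dim M)%N.
Proof.
have dM : dim M = (dim A * 1 * dim (V p.-1))%N by [].
have dW : dim W = (dim (V m) * 1 * 1)%N by [].
rewrite -[dim (ind_rep W)]/(\dim (ind_space W)).
apply: leq_trans (dim_ind_space W) _; rewrite dM dW dim_coker !dim_V.
have := index_torus_le p_pr alphaN alpha2 dimK.
rewrite !muln1 prednK ?(ltnW p_gt1) // => le_i.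
apply: leq_trans (leq_mul le_i (leqnn _)) _.
by rewrite mulnC [(p * _)%N]mulnC mulnA.
Qed.

(** The forms of level_form are the coordinates, in the eigenbasis of
V_m tensor omega^(n-m), of a torus map. The kernel of the induced map is stable under
the unipotent subgroup; an invariant vector of it is spread from the class of some P,
which descends through all the steps of the filtration and so is zero. *)
Lemma tensor_ind_iso : rep_iso M (ind_rep W).
Proof.
have [B BP] := fin_all_exists (fun i : 'I_m.+1 =>
  level_form p_pr p_odd dimK alphaN alpha2 le_mn lt_np (leq_ord i)).
pose w (i : 'I_m.+1) : W := tens (eigenform i : V m) (1 : K^o).
pose F (x : M) : W := \sum_i (B i x : K) *: w i.
have Flin : linear F.
  move=> c x y; rewrite /F scaler_sumr -big_split; apply: eq_bigr => i _ /=.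
  by rewrite lformP scalerDl scalerA.
pose FL : {linear M -> W} := HB.pack F (GRing.isLinear.Build K M W _ F Flin).
have FE x : linfun FL x = F x by rewrite lfunE.
have wT i t : t \in T -> rep_act W t (w i) = om t ^+ (n + i * p.-1) *: w i.
  move=> Tt; rewrite /w [LHS]tens_actE.
  have -> : rep_act (omega2_rep alpha2 k) t (1 : K^o) = om t ^+ (n - m) *: (1 : K^o).
    by rewrite /= scale_lfunE id_lfunE k_eq.
  have -> : rep_act (res_rep (subsetT T) (V m)) t (eigenform i : V m) =
      om t ^+ (m + p.-1 * i) *: (eigenform i : V m).
    exact: eigenform_torus.
  apply/lfunP => lam; rewrite scale_lfunE !tensE scalerA lformZ.
  rewrite [RHS]scalerA; congr (_ *: _).
  rewrite mulrAC -exprD; congr (_ ^+ _ * _).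
  by rewrite addnAC subnKC 1?mulnC //; lia.
have FT : {in T, forall t x, linfun FL (rep_act M t x) = rep_act W t (linfun FL x)}.
  move=> t Tt x; rewrite !FE /F linear_sum; apply: eq_bigr => i _.
  by rewrite linearZ /= (proj1 (BP i)) // wT // scalerA mulrC.
have F0 x : F x = 0 -> forall i, B i x = 0.
  move=> Fx0 j; pose lam : 'Hom(V m, K^o) := linfun (cf alpha j).
  have lamE (R : dhomog 2 K m) : lam R = cf alpha j R by rewrite lfunE.
  have : (F x : tensor (V m) K^o) lam = 0 by rewrite Fx0 zero_lfunE.
  rewrite /F sum_lfunE (bigD1 j) //= big1 => [|i ij].
    rewrite addr0 scale_lfunE tensE lamE cf_eigenform eqxx mulr1n => /eqP.
    rewrite !scaler_eq0 oner_eq0 orbF mulf_eq0 !expf_eq0 oppr_eq0.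
    by rewrite (negPf two_alpha_neq0) !andbF !orbF => /eqP.
  rewrite scale_lfunE tensE lamE cf_eigenform eq_sym (negPf ij) mulr0n.
  by rewrite scale0r scaler0.
have [Phi [Phig PhiE]] := ind_hom FT.
have Phi0 x : Phi x = 0 -> forall g i, B i (rep_act M g x) = 0.
  move=> Px0 g; apply: F0; rewrite -FE -PhiE Px0.
  by rewrite linear0 ffunE.
exists Phi; last by move=> g _ x; exact: Phig.
(* injectivity; the dimensions are compared by dim_ind_le *)
apply: lker0_bij.
  apply/eqP; apply: contraT => /eqP ker0.
  have [|||x [xker x0 xfix]] := @unipotent_fixed p K M
     (fun b => rep_act M (bor 1 b)) (lker Phi) p_pr _ _ _ ker0.
  - by move=> v; rewrite bor10 rep_act1 id_lfunE.
  - by move=> b c v; rewrite rep_actMv borM ?oner_neq0.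
  - by move=> b v; rewrite !memv_ker Phig => /eqP->; rewrite linear0.
  have [y spx] := fixed_spread p_pr xfix.
  have [P eP] := vquot_pi_surj y.
  have Bx := Phi0 x (eqP (etrans (esym (memv_ker Phi x)) xker)).
  case/negP: x0; apply/eqP.
  have [Q Qh eQ] : exists2 Q, Q \is n.-homog & P = iter m.+1 theta Q :> {mpoly K[2]}.
    have H s : (s <= m.+1)%N -> exists2 Q,
        Q \is (n + (m.+1 - s) * p.-1).-homog & P = iter s theta Q :> {mpoly K[2]}.
      elim: s => [_|s IHs lt_sm].
        exists P => //; rewrite subn0; exact: dhomog_is_dhomog.
      have [Q Qh eQ] := IHs (ltnW lt_sm).
      have lt_i : (m - s < m.+1)%N by rewrite ltnS leq_subr.
      have [_ /(_ x P Q)] := BP (Ordinal lt_i).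
      rewrite eP /= subKn // -subSn // => /(_ spx Qh eQ).
      case=> [d _|Q' Q'h eQ']; first exact: Bx.
      by exists Q'; rewrite ?subSS // eQ eQ' -iterSr.
    by have := H m.+1 (leqnn _); rewrite subnn mul0n addn0.
  have y0 : y = 0 by rewrite -eP (coker_zero p_pr Qh eQ).
  apply/(@lfunP _ 'Hom(A, K^o) (V p.-1)) => lam; rewrite (spx lam) big1 ?lfunE //.
  by move=> b _; rewrite y0 !linear0 scale0r.
exact: dim_ind_le.
Qed.

End Numeric.
End Final.

Theorem corollary4p5 (p m : nat) (p_pr : prime p) (p_odd : odd p) (r : int)
    (r_ge : 2 * m%:Z - 1 <= r) (r_le : r <= p%:Z - 3)
    (K : fieldExtType 'F_p) (dimK : \dim {:K} = 2%N)
    (alpha : K) (alphaN : alpha \notin 1%VS)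
    (a : 'F_p) (alpha2 : alpha ^+ 2 = a%:A) :
  rep_iso
    (tens_rep (coker_Dpow K p_pr `|(r + 2)%R|%N m.+1) (sym_rep K p.-1))
    (ind_rep (tens_rep (res_rep (subsetT (torus a)) (sym_rep K m))
                       (omega2_rep alpha2 (r + 2 - m%:Z)))).
Proof. by apply: tensor_ind_iso => //; move: r_ge r_le; lia. Qed.
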